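(* Let $T>0$ and $\mathbb{D}=\{(t,s):0\le s\le t\le T\}$. Consider the integral-algebraic system, for $t\in[0,T]$, $$x(t)=f_1(t)+\int_0^t\bigl(k^{11}(t,s)x(s)+k^{12}(t,s)y(s)\bigr)\,ds,$$ $$0=f_2(t)+\int_0^t\bigl(k^{21}(t,s)x(s)+k^{22}(t,s)y(s)\bigr)\,ds,$$ with $f_2(0)=0$, and suppose that (1) $f_i\in C^1([0,T])$ and $k^{ij}\in C^1(\mathbb{D})$ for all $i,j\in\{1,2\}$; (2) there is a constant $k_0$ with $k^{22}(t,t)\ge k_0>0$ for all $t\in[0,T]$. Then, for the indirect Galerkin method (defined in the context), the convergence order of the approximate solution $u_n=(x_n,y_n)$ to the solution $u=(x,y)$ of the system is equal to the convergence order of the best approximation of $u$ in the space $X_n$ (defined in the context).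
   Context: Spaces. $(L^2[0,T])^2$ carries the inner product $\langle(x,y),(z,w)\rangle=\int_0^T x z\,dt+\int_0^T y w\,dt$ and the induced norm. Let $\{V_i\}_{i\ge1}$ be the Legendre polynomials normalized to be an orthonormal basis of $L^2[-1,1]$ ($V_i$ of degree $i-1$), and let $V_{T_i}(s)=\sqrt{2/T}\,V_i\bigl((2s-T)/T\bigr)$, $s\in[0,T]$, be the shifted Legendre polynomials, an orthonormal basis of $L^2[0,T]$. Put $X_n=\operatorname{span}\{(V_{T_i},0),(0,V_{T_i}):1\le i\le n\}\subset(L^2[0,T])^2$. The best approximation of $u$ in $X_n$ is the orthogonal projection of $u$ onto $X_n$. Differentiated equation. Differentiating the second equation of the system in $t$ and dividing by $k^{22}(t,t)$ gives $$y(t)=-\frac{f_2'(t)}{k^{22}(t,t)}-\frac{k^{21}(t,t)}{k^{22}(t,t)}x(t)-\int_0^t\frac{1}{k^{22}(t,t)}\Bigl(\frac{\partial k^{21}(t,s)}{\partial t}x(s)+\frac{\partial k^{22}(t,s)}{\partial t}y(s)\Bigr)ds .$$ The first equation of the system together with this one is a system of second-kind Volterra equations, which has a unique continuous solution $u=(x,y)$. Indirect Galerkin method. This is the Galerkin method in $X_n$ applied to the pair consisting of the first equation of the system and the differentiated equation. The approximate solution is $u_n=(x_n,y_n)=\bigl(\sum_{i=1}^n a_iV_{T_i},\ \sum_{i=1}^n b_iV_{T_i}\bigr)$, where the coefficients $a_1,\dots,a_n,b_1,\dots,b_n$ solve the linear system, for $j=1,\dots,n$, $$a_j=\int_0^T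 f_1(t)V_{T_j}(t)\,dt+\sum_{i=1}^n a_i\int_0^T\!\!\int_0^t k^{11}(t,s)V_{T_i}(s)V_{T_j}(t)\,ds\,dt+\sum_{i=1}^n b_i\int_0^T\!\!\int_0^t k^{12}(t,s)V_{T_i}(s)V_{T_j}(t)\,ds\,dt,$$ $$b_j=-\int_0^T\frac{f_2'(t)}{k^{22}(t,t)}V_{T_j}(t)\,dt-\sum_{i=1}^n a_i\int_0^T\!\!\int_0^t\frac{1}{k^{22}(t,t)}\frac{\partial k^{21}(t,s)}{\partial t}V_{T_i}(s)V_{T_j}(t)\,ds\,dt-\sum_{i=1}^n a_i\int_0^T\frac{k^{21}(t,t)}{k^{22}(t,t)}V_{T_i}(t)V_{T_j}(t)\,dt-\sum_{i=1}^n b_i\int_0^T\!\!\int_0^t\frac{1}{k^{22}(t,t)}\frac{\partial k^{22}(t,s)}{\partial t}V_{T_i}(s)V_{T_j}(t)\,ds\,dt .$$ *)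

(* Defs.v *)
From HB Require Import structures.
From mathcomp Require Import all_boot all_order all_algebra.
From mathcomp Require Import all_classical all_reals all_analysis.

Set Implicit Arguments.
Unset Strict Implicit.
Unset Printing Implicit Defensive.

Import Order.TTheory GRing.Theory Num.Theory.
Import numFieldNormedType.Exports.

Local Open Scope classical_set_scope.
Local Open Scope ring_scope.

(* C^1 on a closed set is read as: continuous on the set, differentiable in its
   interior, with (partial) derivatives that extend continuously to the set. *)
Definition C1_itv {R : realType} (T : R) (f : R -> R) : Prop :=
  [/\ {within `[0, T], continuous f},
      (forall t : R, t \in `]0, T[ -> derivable f t 1)
    & exists df : R -> R, {within `[0, T], continuous df} /\
        (forall t : R, t \in `]0, T[ -> derive1 f t = df t)].

Definition triangle {R : realType} (T : R) : set (R * R) :=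
  [set p | 0 <= p.2 <= p.1 /\ p.1 <= T].

Definition continuous_on_triangle {R : realType} (T : R) (k : R -> R -> R) :=
  {within triangle T, continuous (fun p : R * R => k p.1 p.2)}.

Definition dt {R : realType} (k : R -> R -> R) (t s : R) : R := derive1 (k^~ s) t.
Definition ds {R : realType} (k : R -> R -> R) (t s : R) : R := derive1 (k t) s.

Definition C1_triangle {R : realType} (T : R) (k : R -> R -> R) : Prop :=
  [/\ continuous_on_triangle T k,
      (forall t s : R, 0 < s < t -> t < T ->
         derivable (k^~ s) t 1 /\ derivable (k t) s 1)
    & exists kt ks : R -> R -> R,
        [/\ continuous_on_triangle T kt, continuous_on_triangle T ks
          & forall t s : R, 0 < s < t -> t < T ->
              dt k t s = kt t s /\ ds k t s = ks t s]].

(* Only continuous functions (the solution and polynomials) are measured with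
   this L^2 structure, so they are kept as functions instead of being taken up
   to almost everywhere equality. *)
Definition inner {R : realType} (T : R) (u v : (R -> R) * (R -> R)) : R :=
  (\int[lebesgue_measure]_(t in `[0, T]) (u.1 t * v.1 t)) +
  (\int[lebesgue_measure]_(t in `[0, T]) (u.2 t * v.2 t)).

Definition L2norm {R : realType} (T : R) (u : (R -> R) * (R -> R)) : R :=
  Num.sqrt (inner T u u).

(* Rodrigues' formula *)
Definition legendre {R : realType} (i : nat) : {poly R} :=
  (2 ^+ i * i`!%:R)^-1 *: derivn i (('X^2 - 1) ^+ i).

(* Indices start at 0: [legendreN i] has degree [i]. *)
Definition legendreN {R : realType} (i : nat) : {poly R} :=
  (Num.sqrt (\int[lebesgue_measure]_(s in `[(-1 : R), 1])
               ((legendre i).[s] ^+ 2)))^-1 *: legendre i.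

Definition shifted_legendre {R : realType} (T : R) (i : nat) (s : R) : R :=
  Num.sqrt (2 / T) * (legendreN i).[(2 * s - T) / T].

Definition expansion {R : realType} (T : R) (n : nat) (a b : 'rV[R]_n)
    : (R -> R) * (R -> R) :=
  (fun t => \sum_(i < n) a 0 i * shifted_legendre T i t,
   fun t => \sum_(i < n) b 0 i * shifted_legendre T i t).

Definition Xspace {R : realType} (T : R) (n : nat)
    : set ((R -> R) * (R -> R)) :=
  [set v | exists a b : 'rV[R]_n, v = expansion T a b].

Definition orthogonal_projection {R : realType} (T : R) (n : nat)
    (u p : (R -> R) * (R -> R)) : Prop :=
  Xspace T n p /\ forall v, Xspace T n v -> inner T (u - p) v = 0.

Definition continuous_solution {R : realType} (T : R) (f1 f2 : R -> R)
    (k11 k12 k21 k22 : R -> R -> R) (u : (R -> R) * (R -> R)) : Prop :=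
  [/\ {within `[0, T], continuous u.1}, {within `[0, T], continuous u.2},
      (forall t : R, t \in `[0, T] ->
         u.1 t = f1 t + \int[lebesgue_measure]_(s in `[0, t])
                          (k11 t s * u.1 s + k12 t s * u.2 s))
    & (forall t : R, t \in `[0, T] ->
         0 = f2 t + \int[lebesgue_measure]_(s in `[0, t])
                      (k21 t s * u.1 s + k22 t s * u.2 s))].

(* The derivatives f2' and [dt k] are only meaningful in the interior of the
   interval and of the triangle; the boundaries are negligible below. *)
Definition galerkin_system {R : realType} (T : R) (f1 f2 : R -> R)
    (k11 k12 k21 k22 : R -> R -> R) (n : nat) (a b : 'rV[R]_n) : Prop :=
  let V := shifted_legendre T in
  let mu := @lebesgue_measure R in
  forall j : 'I_n,
    a 0 j =
        (\int[mu]_(t in `[0, T]) (f1 t * V j t))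
      + (\sum_(i < n) a 0 i *
          (\int[mu]_(t in `[0, T]) (\int[mu]_(s in `[0, t])
            (k11 t s * V i s * V j t))))
      + (\sum_(i < n) b 0 i *
          (\int[mu]_(t in `[0, T]) (\int[mu]_(s in `[0, t])
            (k12 t s * V i s * V j t))))
    /\
    b 0 j =
      - (\int[mu]_(t in `[0, T]) (derive1 f2 t / k22 t t * V j t))
      - (\sum_(i < n) a 0 i *
          (\int[mu]_(t in `[0, T]) (\int[mu]_(s in `[0, t])
            ((k22 t t)^-1 * dt k21 t s * V i s * V j t))))
      - (\sum_(i < n) a 0 i *
          (\int[mu]_(t in `[0, T]) (k21 t t / k22 t t * V i t * V j t)))
      - (\sum_(i < n) b 0 i *
          (\int[mu]_(t in `[0, T]) (\int[mu]_(s in `[0, t])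
            ((k22 t t)^-1 * dt k22 t s * V i s * V j t)))).

(* Main.v *)
Require Import Defs.
From mathcomp Require Import all_boot all_order all_algebra.
From mathcomp Require Import all_classical all_reals all_analysis.
From mathcomp Require Import ring lra.
Set Implicit Arguments.
Unset Strict Implicit.
Unset Printing Implicit Defensive.
Import Order.TTheory GRing.Theory Num.Theory.
Import numFieldNormedType.Exports.
Local Open Scope classical_set_scope.
Local Open Scope ring_scope.

(** Write the solution as [u = g + N u + K u], where [K] is a matrix of Volterra
    operators with continuous kernels and [N (x, y) = (0, m x)] with
    [m t = - k21 t t / k22 t t].  The Galerkin solution satisfies
    [u_n = P_n (g + N u_n + K u_n)] with [P_n] the orthogonal projection onto
    [X_n], so [e = u_n - P_n u] satisfies
    [e = P_n (N + K) e - P_n (N + K) (u - P_n u)].  A Volterra operator maps the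
    unit ball of L^2 into a uniformly equicontinuous set, which Bernstein
    polynomials approximate uniformly, so [(1 - P_n) K] tends to 0 in operator
    norm.  The operator [N] is not compact, but on a component
    [x = P_n h + r] with [h] in the range of [K] it gives [m x = m h + m (x - h)],
    where [m h] is again of Volterra type and [x - h] is small.  Hence [e] solves
    the unprojected Volterra system up to a small error, and Gronwall's
    inequality bounds [e] by [u - P_n u].  Applied to the homogeneous system
    the same bound gives unique solvability. *)

(** * Integrals of continuous functions on a segment *)

(** The lower half of the order relation is the optimality of the projection, with constant 1; only
    the upper half needs the stability argument. There, smallness must be uniform in the unknown
    function. Cauchy-Schwarz bounds both the supremum and the modulus of continuity of a Volterra
    image by the L^2 norm of its argument, and the Bernstein error depends on nothing else, so one
    polynomial degree serves all arguments. The bound thus obtained on the projection defect holds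
    for large n only, hence the thresholds [N]; it is taken small compared with the Gronwall
    constant, so that the error it creates is absorbed by the left-hand side. A second obstacle is
    regularity: derivatives are known only inside the interval and inside the triangle. The Volterra
    integral is therefore never differentiated. Its Leibniz rule is proved in integrated form, and
    the pointwise equation is recovered from a vanishing integral. Under integrals, derivatives are
    exchanged for their continuous extensions, which differ from them only on null sets. *)

Definition cont {R : realType} (a b : R) (f : R -> R) : Prop :=
  {within `[a, b], continuous f}.
Local Notation integral a b f := (Rintegral lebesgue_measure `[a, b]%classic f).

Section IntegralOfContinuous.
Context {R : realType}.
Implicit Types (a b c x y : R) (f g h : R -> R).
Notation mu := (@lebesgue_measure R).

Lemma cont_integrable a b f : cont a b f -> mu.-integrable `[a, b] (EFin \o f).
Proof.
by move=> cf; apply: continuous_compact_integrable => //; exact: segment_compact.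
Qed.

Lemma cont_sub a b c d f : a <= c -> d <= b -> cont a b f -> cont c d f.
Proof.
move=> ac db; apply: continuous_subspaceW => x /=; rewrite !in_itv /= => /andP[cx xd].
by rewrite (le_trans ac cx) (le_trans xd db).
Qed.

Lemma cont_eq a b f g : {in `[a, b], f =1 g} -> cont a b f -> cont a b g.
Proof.
by move=> fg; apply: subspace_eq_continuous => x; rewrite inE; exact: fg.
Qed.

Lemma contD a b f g : cont a b f -> cont a b g -> cont a b (fun x => f x + g x).
Proof. exact: within_continuousD. Qed.

Lemma contB a b f g : cont a b f -> cont a b g -> cont a b (fun x => f x - g x).
Proof. exact: within_continuousB. Qed.

Lemma contM a b f g : cont a b f -> cont a b g -> cont a b (fun x => f x * g x).
Proof. by move=> cf cg x; apply: continuousM; [exact: cf|exact: cg]. Qed.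

Lemma cont_cst a b (k : R) : cont a b (fun=> k).
Proof. by move=> x; exact: cvg_cst. Qed.

Lemma contZ a b (k : R) f : cont a b f -> cont a b (fun x => k * f x).
Proof. by move=> cf; apply: contM => //; exact: cont_cst. Qed.

Lemma contN a b f : cont a b f -> cont a b (fun x => - f x).
Proof. by move=> cf x; apply: continuousN; exact: cf. Qed.

Lemma contV a b f : {in `[a, b], forall x, f x != 0} ->
  cont a b f -> cont a b (fun x => (f x)^-1).
Proof.
move=> f0 cf; apply: (@within_continuous_comp _ _ _ _ f (fun x => x^-1)) => //.
by move=> _ /set_mem[x xab <-]; apply: inv_continuous; exact: f0.
Qed.

Lemma contX2 a b f : cont a b f -> cont a b (fun x => f x ^+ 2).
Proof. by move=> cf; exact: contM. Qed.

Lemma cont_sum a b n (F : 'I_n -> R -> R) : (forall i, cont a b (F i)) ->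
  cont a b (fun x => \sum_(i < n) F i x).
Proof.
elim: n F => [|n IH] F cF.
  by apply: (cont_eq _ (@cont_cst a b 0)) => x _; rewrite big_ord0.
apply: (cont_eq _ (contD (IH _ (fun i => cF (widen_ord (leqnSn n) i))) (cF ord_max))).
by move=> x _; rewrite big_ord_recr.
Qed.

Lemma cont_horner a b (p : {poly R}) : cont a b (horner p).
Proof. by apply: continuous_subspaceT; exact: continuous_horner. Qed.

Lemma eq_integral_cc a b f g : {in `[a, b], f =1 g} ->
  integral a b f = integral a b g.
Proof. by move=> fg; apply: eq_Rintegral => x; rewrite inE; exact: fg. Qed.

Lemma integralDc a b f g : cont a b f -> cont a b g ->
  integral a b (fun x => f x + g x) = integral a b f + integral a b g.
Proof. by move=> cf cg; rewrite RintegralD//; exact: cont_integrable. Qed.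

Lemma integralBc a b f g : cont a b f -> cont a b g ->
  integral a b (fun x => f x - g x) = integral a b f - integral a b g.
Proof. by move=> cf cg; rewrite RintegralB//; exact: cont_integrable. Qed.

Lemma integralZc a b k f : cont a b f ->
  integral a b (fun x => k * f x) = k * integral a b f.
Proof. by move=> cf; rewrite RintegralZl//; exact: cont_integrable. Qed.

Lemma integralNc a b f : cont a b f ->
  integral a b (fun x => - f x) = - integral a b f.
Proof.
move=> cf; rewrite -mulN1r -integralZc//.
by apply: eq_integral_cc => x _; rewrite mulN1r.
Qed.

Lemma integral0c a b : integral a b (fun=> 0 : R) = 0.
Proof. by rewrite /Rintegral integral0. Qed.

Lemma integral_sumc a b n (F : 'I_n -> R -> R) : (forall i, cont a b (F i)) ->
  integral a b (fun x => \sum_(i < n) F i x) = \sum_(i < n) integral a b (F i).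
Proof.
elim: n F => [|n IH] F cF.
  rewrite big_ord0 -[RHS](integral0c a b).
  by apply: eq_integral_cc => x _; rewrite big_ord0.
rewrite big_ord_recr /= -IH// -integralDc//; last exact: cont_sum.
by apply: eq_integral_cc => x _; rewrite big_ord_recr.
Qed.

Lemma integral_ge0c a b f : {in `[a, b], forall x, 0 <= f x} ->
  0 <= integral a b f.
Proof. by move=> f0; apply: Rintegral_ge0 => x; exact: f0. Qed.

Lemma le_integralc a b f g : cont a b f -> cont a b g ->
  {in `[a, b], forall x, f x <= g x} -> integral a b f <= integral a b g.
Proof.
by move=> cf cg fg; apply: le_Rintegral => //; exact: cont_integrable.
Qed.

Lemma integral_cstc a b k : a <= b -> integral a b (fun=> k) = k * (b - a).
Proof.
move=> ab; rewrite Rintegral_cst//; congr (_ * _).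
have := @lebesgue_measure_itv R `[a, b]; rewrite /= lte_fin => ->.
by move: ab; rewrite le_eqVlt => /predU1P[->|->//]; rewrite ltxx subrr.
Qed.

Lemma integral_split a b c f : a <= b <= c -> cont a c f ->
  integral a c f = integral a b f + integral b c f.
Proof.
move=> /andP[ab bc] cf; apply/eqP; rewrite addrC -subr_eq; apply/eqP.
rewrite (@Rintegral_itvB _ f (BLeft a) (BRight c) b); last 3 first.
- exact: cont_integrable.
- by rewrite bnd_simp.
- by rewrite bnd_simp.
rewrite Rintegral_itv_obnd_cbnd//.
apply: integrableS (cont_integrable cf) => //.
by move=> x /=; rewrite !in_itv /= => /andP[/ltW bx ->]; rewrite (le_trans ab).
Qed.

Lemma integral_sqr_ge0 a b f : 0 <= integral a b (fun x => f x ^+ 2).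
Proof. by apply: integral_ge0c => x _; exact: sqr_ge0. Qed.

Lemma cauchy_schwarz a b f g : cont a b f -> cont a b g ->
  integral a b (fun x => f x * g x) ^+ 2 <=
  integral a b (fun x => f x ^+ 2) * integral a b (fun x => g x ^+ 2).
Proof.
move=> cf cg.
set A := integral a b (fun x => f x ^+ 2).
set C := integral a b (fun x => g x ^+ 2).
set B := integral a b _.
have quad l : 0 <= A - 2 * l * B + l ^+ 2 * C.
  rewrite -integralZc; last exact: contM.
  rewrite -integralZc; last exact: contX2.
  rewrite -integralBc; [|exact: contX2|by apply: contZ; exact: contM].
  rewrite -integralDc; [|apply: contB; [exact: contX2|]|].
  - apply: integral_ge0c => x _.
    by have := sqr_ge0 (f x - l * g x); nra.
  - by apply: contZ; exact: contM.
  - by apply: contZ; exact: contX2.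
have A0 : 0 <= A by exact: integral_sqr_ge0.
have : 0 <= C by exact: integral_sqr_ge0.
rewrite le_eqVlt => /predU1P[C0|C0].
  have [B0|B0] := eqVneq B 0; first by rewrite B0 -C0; nra.
  (* With [C = 0] the quadratic is affine in [l], and this [l] gives it the value -1. *)
  have := quad ((A + 1) / (2 * B)).
  rewrite -C0 mulr0 addr0 (_ : 2 * _ * B = A + 1); last by field.
  by lra.
have := quad (B / C).
rewrite (_ : A - _ + _ = (A * C - B ^+ 2) / C); last by field; rewrite gt_eqF.
by rewrite pmulr_lge0 ?invr_gt0// subr_ge0.
Qed.

Lemma integral_cont a b f : a <= b -> cont a b f -> cont a b (fun t => integral a t f).
Proof.
move=> ab cf; apply: parameterized_integral_continuous => //.
exact: cont_integrable.
Qed.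

Lemma integral_deriv a b f x : cont a b f -> x \in `]a, b[ ->
  is_derive x 1 (fun t => integral a t f) (f x).
Proof.
move=> cf xab; have := xab; rewrite in_itv /= => /andP[ax xb].
have [] := @continuous_FTC1_closed _ f a x b xb (cont_integrable cf) ax.
  by apply: within_continuous_continuous xab => //; exact: lt_trans xb.
by move=> df <-; split=> //; rewrite derive1E.
Qed.

Lemma integral_ftc2 a b f F : a <= b -> cont a b f -> cont a b F ->
  {in `]a, b[, forall x, is_derive x 1 F (f x)} ->
  integral a b f = F b - F a.
Proof.
rewrite le_eqVlt => /predU1P[-> _ _ _|ab cf cF dF].
  by rewrite subrr set_itv1 Rintegral_set1.
rewrite /Rintegral (continuous_FTC2 ab cf (F := F))//.
- have [cF1 cF2 cF3] := (continuous_within_itvP F ab).1 cF.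
  by split=> // x xab; have := dF _ xab.
- by move=> x xab; have := dF _ xab => -[_ <-]; rewrite derive1E.
Qed.

(** Near an interior point the integral is constantly 0, while its derivative there is [f x]. This
    turns an integrated equation back into a pointwise one. *)
Lemma integral_eq0_cont a b f : a <= b -> cont a b f ->
  {in `[a, b], forall t, integral a t f = 0} -> {in `]a, b[, forall x, f x = 0}.
Proof.
move=> ab cf I0 x xab; have [_ <-] := integral_deriv cf xab.
rewrite (@near_eq_derive _ _ _ _ (fun=> 0 : R)) ?derive_cst//.
near=> y; apply: I0; apply: subset_itv_oo_cc.
near: y; exact: near_in_itvoo.
Unshelve. all: by end_near. Qed.

(** End points are null, so [f] may take any value there. Derivatives known only in the interior are
    integrated in this way, through a continuous extension [g]. *)
Lemma eq_integral_oo a b f g : cont a b g -> {in `]a, b[, f =1 g} ->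
  integral a b f = integral a b g.
Proof.
move=> cg fg; have mg : measurable_fun `]a, b[ g.
  apply: (@measurable_funS _ _ _ _ `[a, b]) => //; first exact: subset_itv_oo_cc.
  apply/measurable_realfun.measurable_EFinP.
  exact: (measurable_int mu (cont_integrable cg)).
rewrite /Rintegral; congr fine; apply: eq_integral_itv_bounded => //.
by apply: (eq_measurable_fun g) => // t; rewrite inE => tT; rewrite fg.
Qed.

Lemma le_integral_oo a b f g : cont a b f -> cont a b g ->
  {in `]a, b[, forall x, f x <= g x} -> integral a b f <= integral a b g.
Proof.
move=> cf cg fg; rewrite -subr_ge0 -integralBc//.
have cgf : cont a b (fun x => g x - f x) by exact: contB.
(* The sign of [g - f] is given only inside, where it agrees with its absolute value. *)
have cn : cont a b (fun x => `|g x - f x|).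
  by move=> x; apply: (continuous_comp (cgf x)); exact: norm_continuous.
rewrite (eq_integral_oo cn) => [|x xab]; last by rewrite ger0_norm// subr_ge0 fg.
exact: integral_ge0c.
Qed.

Lemma integral_norm_le_oo a b f (c : R) : a <= b -> cont a b f ->
  {in `]a, b[, forall x, `|f x| <= c} -> `|integral a b f| <= c * (b - a).
Proof.
move=> ab cf fc; rewrite ler_norml -mulNr -!integral_cstc//.
by apply/andP; split; apply: le_integral_oo => //; try exact: cont_cst;
  move=> x /fc; rewrite ler_norml => /andP[].
Qed.

End IntegralOfContinuous.

(** * Compactness, kernels on the triangle, Gronwall's inequality *)

Section HeineCantor.
Context {R : realType}.

(** On some ball of radius [d] around each point, [f] stays within [e / 2] of its value at the
    centre; for points of the half ball every radius below [d / 2] then works. The near-covering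
    form of compactness makes the radius uniform. *)
Lemma heine_cantor (X : pseudoMetricType R) (A : set X) (f : X -> R) :
  compact A -> {within A, continuous f} ->
  forall e : R, 0 < e -> exists2 d : R, 0 < d &
    forall x y, A x -> A y -> ball x d y -> `|f x - f y| < e.
Proof.
move=> cA /subspace_continuousP cf e e0.
pose P (d : R) x := A x -> forall y, A y -> ball x d y -> `|f x - f y| < e.
have : \forall d \near 0^'+, A `<=` P d.
  apply: ((compact_near_coveringP A).1 cA) => x Ax.
  have /cvgrPdist_lt/(_ (e / 2)) := cf x Ax.
  rewrite divr_gt0// => /(_ isT); rewrite /prop_near1 nbhs_simpl /= /within /=.
  move=> /nbhs_ballP[d /= d0 xd].
  exists (ball x (d / 2), [set r | 0 < r < d / 2]) => /=.
    split; first by apply: nbhsx_ballx; rewrite divr_gt0.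
    near=> r; apply/andP; split => //; near: r; apply: nbhs_right_lt.
    by rewrite divr_gt0.
  move=> [z r] /= [xz /andP[r0 rd]] Az y Ay zy.
  rewrite /from_subspace in xd; have := xd z (le_ball _ xz) Az.
  rewrite ler_pdivrMr// ler_peMr ?ler1n//; last exact: ltW.
  move=> /(_ isT).
  have := xd y _ Ay; rewrite (splitr d) => /(_ (ball_triangle xz (le_ball (ltW rd) zy))).
  rewrite !ltr_norml; move=> /andP[h1 h2] /andP[h3 h4].
  by apply/andP; split; lra.
move=> [d /= d0 dP]; exists (d / 2); first by rewrite divr_gt0.
move=> x y Ax Ay xy; apply: (dP (d / 2)) => //=; last by rewrite divr_gt0.
by rewrite sub0r normrN gtr0_norm ?divr_gt0// gtr_pMr// invf_lt1// ltr1n.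
Unshelve. all: by end_near. Qed.
End HeineCantor.

Section Gronwall.
Context {R : realType}.

(** The derivative of [G] is at most [(expR (- c * t) - 1) * r t], which is nonpositive, so
    [G T <= G 0 = 0]. Bounding the integral of [w] is what is wanted: [w] will be a sum of squares,
    whose integral is a squared norm. *)
Lemma gronwall (T c : R) (w r : R -> R) : 0 <= T -> 0 <= c ->
  cont 0 T w -> cont 0 T r -> {in `[0, T], forall t, 0 <= r t} ->
  {in `[0, T], forall t, w t <= r t + c * integral 0 t w} ->
  integral 0 T w <= expR (c * T) * integral 0 T r.
Proof.
move=> T0 c0 cw cr r0 wr.
pose G t := expR (- c * t) * integral 0 t w - integral 0 t r.
pose dG t := expR (- c * t) * (w t - c * integral 0 t w) - r t.
have dGE t : t \in `]0, T[ -> is_derive t 1 G (dG t).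
  move=> t0T; rewrite /G.
  have dw := integral_deriv cw t0T; have dr := integral_deriv cr t0T.
  apply: is_derive_eq.
  by rewrite /dG /GRing.scale /=; ring.
have cG : cont 0 T G.
  apply: contB; last exact: integral_cont.
  apply: contM; last exact: integral_cont.
  apply: continuous_subspaceT => x.
  by apply: continuous_comp; [exact: mulrl_continuous|exact: continuous_expR].
have G0 : G 0 = 0 by rewrite /G set_itv1 !Rintegral_set1 mulr0 subrr.
have le0 : G T <= 0 -> integral 0 T w <= expR (c * T) * integral 0 T r.
  rewrite /G mulNr expRN subr_le0 mulrC ler_pdivrMr ?expR_gt0//.
  by rewrite mulrC.
apply: le0; rewrite -G0; apply: (ler0_derive1_nincr _ _ cG) => //.
  by move=> t t0T; have [] := dGE t t0T.
move=> t t0T; rewrite derive1E; have [_ ->] := dGE t t0T.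
have tT : t \in `[0, T] by exact: subset_itv_oo_cc.
rewrite /dG subr_le0 (@le_trans _ _ (expR (- c * t) * r t))//.
  by rewrite ler_pM2l ?expR_gt0// lerBlDr wr.
rewrite ler_piMl ?r0// -expR0 ler_expR mulNr oppr_le0 mulr_ge0//.
by move: tT; rewrite in_itv /= => /andP[].
Qed.
End Gronwall.

(** * Continuous kernels on the triangle *)

Section Triangle.
Context {R : realType}.
Implicit Types (T : R) (k : R -> R -> R).

Lemma within_continuous_map (X Y Z : topologicalType) (A : set X) (B : set Y)
    (phi : X -> Y) (f : Y -> Z) :
  (forall x, A x -> B (phi x)) -> {within A, continuous phi} ->
  {within B, continuous f} -> {within A, continuous (f \o phi)}.
Proof.
move=> AB /subspace_continuousP cphi /subspace_continuousP cf.
apply/subspace_continuousP => x Ax U /(cf _ (AB _ Ax)) fU.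
have {fU} := cphi x Ax _ fU; rewrite /= /from_subspace /within /= !nbhs_simpl /=.
by apply: filterS => y /= h Ay; apply: h => //; exact: AB.
Qed.

Lemma continuous_pair (X Y Z : topologicalType) (f : X -> Y) (g : X -> Z) :
  continuous f -> continuous g -> continuous (fun x => (f x, g x)).
Proof. by move=> cf cg x; apply: cvg_pair; [exact: cf|exact: cg]. Qed.

(** A continuous map sends a rectangle onto the triangle; its side [t = 0] collapses to the corner,
    which is why [t = 0] needs its own preimage. *)
Lemma triangle_compact T : 0 <= T -> compact (triangle T).
Proof.
move=> T0; pose phi (p : R * R) := (p.1, p.1 * p.2).
have -> : triangle T = phi @` (`[0, T] `*` `[0, 1]).
  apply/seteqP; split => [[t s] [/= /andP[s0 st] tT]|_ [[t x] [/= + + <-]]]; last first.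
    rewrite /triangle !in_itv /= => /andP[t0 tT] /andP[x0 x1].
    by rewrite mulr_ge0// ler_piMr.
  have [t0|t0] := eqVneq t 0.
    exists (0, 0); rewrite /phi /= ?in_itv /= ?lexx ?T0 ?ler01//.
    by rewrite t0 in st *; congr (_, _); apply/eqP; rewrite mulr0 eq_le s0 st.
  have tp : 0 < t by rewrite lt_def t0 (le_trans s0).
  exists (t, s / t); rewrite /phi /= ?in_itv /= ?tT ?(ltW tp)//.
    by split => //; rewrite divr_ge0 ?(ltW tp)//= ler_pdivrMr// mul1r.
  by congr (_, _); field.
apply: continuous_compact; last by apply: compact_setX; exact: segment_compact.
apply: continuous_subspaceT; apply: continuous_pair => p; first exact: cvg_fst.
by apply: cvgM; [exact: cvg_fst|exact: cvg_snd].
Qed.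

Lemma kernel_unif T k : 0 <= T -> continuous_on_triangle T k ->
  forall e : R, 0 < e -> exists2 d : R, 0 < d &
    forall t s t' s', triangle T (t, s) -> triangle T (t', s') ->
      `|t - t'| < d -> `|s - s'| < d -> `|k t s - k t' s'| < e.
Proof.
move=> T0 ck e e0; have [d d0 dP] := heine_cantor (triangle_compact T0) ck e0.
by exists d => // t s t' s' ts ts' tt' ss'; exact: (dP (t, s) (t', s')).
Qed.

Lemma kernel_bound T k : 0 <= T -> continuous_on_triangle T k ->
  exists2 M : R, 0 < M & forall t s, triangle T (t, s) -> `|k t s| <= M.
Proof.
move=> T0 ck.
have T00 : triangle T !=set0 by exists (0, 0); rewrite /triangle /= lexx.
have [p pT pM] := compact_EVT_max T00 (triangle_compact T0) ck.
have [q qT qM] := compact_EVT_min T00 (triangle_compact T0) ck.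
exists (`|k p.1 p.2| + `|k q.1 q.2| + 1).
  by rewrite ltr_wpDl// addr_ge0.
move=> t s /mem_set ts; have := pM _ ts; have := qM _ ts => /= h1 h2.
have := ler_norm (k p.1 p.2); have := ler_norm (- k q.1 q.2); rewrite normrN.
have := normr_ge0 (k p.1 p.2); have := normr_ge0 (k q.1 q.2).
by rewrite ler_norml => *; apply/andP; split; lra.
Qed.

(** [f] is viewed as a kernel independent of [s] and read back on the diagonal. *)
Lemma cont_bound T f : 0 <= T -> cont 0 T f ->
  exists2 M : R, 0 < M & {in `[0, T], forall t, `|f t| <= M}.
Proof.
move=> T0 cf.
have [M M0 MP] : exists2 M : R, 0 < M &
    forall t s, triangle T (t, s) -> `|f t| <= M.
  apply: (@kernel_bound T (fun t _ => f t)) => //.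
  apply: (within_continuous_map (B := `[0, T]) (phi := fst) _ _ cf).
    by move=> [t s] /= [/andP[s0 st] tT]; rewrite in_itv /= tT (le_trans s0).
  by apply: continuous_subspaceT => p; exact: cvg_fst.
exists M => // t; rewrite in_itv /= => /andP[t0 tT].
by apply: (MP t t); rewrite /triangle /= t0 lexx.
Qed.

Lemma kernelM T f k : cont 0 T f -> continuous_on_triangle T k ->
  continuous_on_triangle T (fun t s => f t * k t s).
Proof.
move=> cf ck p; apply: continuousM; last exact: ck.
apply: (within_continuous_map (B := `[0, T]) (phi := fst) _ _ cf).
  by move=> [t s] /= [/andP[s0 st] tT]; rewrite in_itv /= tT (le_trans s0).
by apply: continuous_subspaceT => q; exact: cvg_fst.
Qed.

Lemma kernel_row T k t : t \in `[0, T] -> continuous_on_triangle T k ->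
  cont 0 t (k t).
Proof.
rewrite in_itv /= => /andP[t0 tT] ck.
apply: (within_continuous_map (phi := fun s => (t, s)) _ _ ck).
  by move=> s /=; rewrite in_itv /triangle /= tT => ->.
apply: continuous_subspaceT; apply: continuous_pair => x; last exact: cvg_id.
exact: cvg_cst.
Qed.

Lemma kernel_col T k s : 0 <= s -> continuous_on_triangle T k ->
  cont s T (k^~ s).
Proof.
move=> s0 ck.
apply: (within_continuous_map (phi := fun t => (t, s)) _ _ ck).
  by move=> t /=; rewrite in_itv /triangle /= s0 => /andP[-> ->].
apply: continuous_subspaceT; apply: continuous_pair => x; first exact: cvg_id.
exact: cvg_cst.
Qed.

Lemma kernel_diag T k : continuous_on_triangle T k -> cont 0 T (fun t => k t t).
Proof.
move=> ck; apply: (within_continuous_map (phi := fun t => (t, t)) _ _ ck).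
  by move=> t /=; rewrite in_itv /triangle /= lexx => /andP[-> ->].
by apply: continuous_subspaceT; apply: continuous_pair => x; exact: cvg_id.
Qed.

End Triangle.

(** * Bernstein polynomials *)

Section Bernstein.
Context {R : realType}.

(* [bernstein n phi] is the mean of [phi] under the binomial law of parameters
   [n] and ['X], defined by conditioning on one trial. *)
Fixpoint bernstein (n : nat) (phi : nat -> R) : {poly R} :=
  if n is m.+1 then
    'X * bernstein m (phi \o S) + (1 - 'X) * bernstein m phi
  else (phi 0%N)%:P.

Lemma size_bernstein n phi : (size (bernstein n phi) <= n.+1)%N.
Proof.
elim: n phi => [|n IH] phi /=; first exact: size_polyC_leq1.
have sX : (size (1 - 'X : {poly R})%R <= 2)%N.
  by rewrite -opprB size_polyN -[1]/(1%:P) size_XsubC.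
rewrite (leq_trans (size_polyD _ _))// geq_max; apply/andP; split.
  by rewrite (leq_trans (size_polyMleq _ _))// size_polyX /= ltnS IH.
rewrite (leq_trans (size_polyMleq _ _))//.
by rewrite -subn1 leq_subLR (leq_trans (leq_add sX (IH phi))).
Qed.

Lemma bernsteinE n phi x : (bernstein n.+1 phi).[x] =
  x * (bernstein n (phi \o S)).[x] + (1 - x) * (bernstein n phi).[x].
Proof. by rewrite /= !hornerE. Qed.

Lemma le_bernstein n phi psi x : 0 <= x <= 1 ->
  (forall k, (k <= n)%N -> phi k <= psi k) ->
  (bernstein n phi).[x] <= (bernstein n psi).[x].
Proof.
move=> /andP[x0 x1]; elim: n phi psi => [|n IH] phi psi le.
  by rewrite /= !hornerE le.
rewrite !bernsteinE lerD// ler_wpM2l ?subr_ge0//; apply: IH => k kn.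
  exact: le.
by rewrite le// leqW.
Qed.

Lemma bernstein_lin n a b phi psi x :
  (bernstein n (fun k => a * phi k + b * psi k)).[x] =
  a * (bernstein n phi).[x] + b * (bernstein n psi).[x].
Proof.
elim: n phi psi => [|n IH] phi psi; first by rewrite /= !hornerE.
rewrite !bernsteinE IH (IH (phi \o S) (psi \o S)); ring.
Qed.

Lemma bernstein_cst n (c x : R) : (bernstein n (fun=> c)).[x] = c.
Proof.
elim: n => [|n IH]; first by rewrite /= !hornerE.
by rewrite bernsteinE !IH; ring.
Qed.

(** Variance of the binomial law plus squared bias. A success in the conditioned trial amounts to
    replacing [c] by [c - 1], so the induction needs every [c]; the use is at [c = n x], where the
    bias vanishes. *)
Lemma bernstein_sqr n (c x : R) : (bernstein n (fun k => (k%:R - c) ^+ 2)).[x] =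
  n%:R * x * (1 - x) + (n%:R * x - c) ^+ 2.
Proof.
elim: n c => [|n IH] c; first by rewrite /= !hornerE.
rewrite bernsteinE IH.
have -> : bernstein n ((fun k => (k%:R - c) ^+ 2) \o S) =
          bernstein n (fun k => (k%:R - (c - 1)) ^+ 2).
  by congr bernstein; apply/funext => k /=; rewrite -natr1; ring.
by rewrite IH -natr1; ring.
Qed.

(** Chebyshev's argument: a node closer than [d] contributes at most [e], and a node at distance
    [D >= d] at most [2 M <= 2 M (D / d)^2], whose mean is controlled by the variance. The bound
    sees [f] only through [M], [e] and [d]. *)
Lemma bernstein_approx (T M e d : R) (f : R -> R) (n : nat) :
  0 < T -> 0 <= e -> 0 < d -> (0 < n)%N ->
  {in `[0, T], forall t, `|f t| <= M} ->
  {in `[0, T] &, forall t s, `|t - s| < d -> `|f t - f s| <= e} ->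
  exists2 p : {poly R}, (size p <= n.+1)%N &
    {in `[0, T], forall t, `|f t - p.[t]| <= e + 2 * M * T ^+ 2 / (d ^+ 2 * n%:R)}.
Proof.
move=> T0 e0 d0 n0 fM fe.
have n0R : 0 < n%:R :> R by rewrite ltr0n.
pose phi k : R := f (k%:R * T / n%:R).
exists (bernstein n phi \Po (T^-1 *: 'X)).
  rewrite (leq_trans (size_comp_poly_leq _ _))//.
  rewrite size_scale ?invr_eq0 ?gt_eqF// size_polyX muln1 ltnS.
  by rewrite -subn1 leq_subLR add1n size_bernstein.
move=> t tT; rewrite horner_comp hornerZ hornerX; set x := _ * t.
have [t0 t1] : 0 <= t /\ t <= T by move: tT; rewrite in_itv /= => /andP[].
have tE : t = T * x by rewrite /x mulrA mulfV ?mul1r// gt_eqF.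
have x01 : 0 <= x <= 1.
  by rewrite /x mulr_ge0 ?invr_ge0 ?(ltW T0)//= mulrC ler_pdivrMr// mul1r.
have M0 : 0 <= M by exact: le_trans (fM _ tT).
pose D := e + 2 * M * T ^+ 2 / (d ^+ 2 * n%:R); rewrite -[leRHS]/D.
(* With [t = T x], the distance from [t] to the [k]-th node is [T / n] times [|k - n x|], hence the
   factor [T^2 / n^2]. The variance [n x (1 - x)] is at most [n], which leaves a single [n] in the
   denominator of [D]. *)
pose c := 2 * M * T ^+ 2 / (d ^+ 2 * n%:R ^+ 2).
have c0 : 0 <= c by rewrite /c; do ![apply: sqr_ge0 | apply: divr_ge0 | apply: mulr_ge0 => //].
pose psi k : R := e + c * (k%:R - n%:R * x) ^+ 2.
have cE k : `|f t - phi k| <= psi k \/ (n < k)%N.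
  have [kn|kn] := leqP k n; [left|by right].
  have kT : k%:R * T / n%:R \in `[0, T].
    rewrite in_itv /= divr_ge0 ?mulr_ge0 ?(ltW T0)//=.
    by rewrite ler_pdivrMr// mulrC ler_pM2l// ler_nat.
  have [lt_d|ge_d] := ltrP `|t - k%:R * T / n%:R| d.
    by rewrite (le_trans (fe _ _ tT kT lt_d))// lerDl mulr_ge0 ?sqr_ge0.
  rewrite (@le_trans _ _ (2 * M))//.
    by rewrite (le_trans (ler_normB _ _))// mulr_natl mulr2n lerD// fM.
  have -> : psi k = e + 2 * M * ((t - k%:R * T / n%:R) / d) ^+ 2.
    by rewrite /psi /c tE; field; rewrite !gt_eqF.
  rewrite ler_wpDl// ler_peMr ?mulr_ge0// -[leRHS]real_normK ?num_real//.
  by rewrite exprn_ege1// normrM normfV (gtr0_norm d0) ler_pdivlMr// mul1r.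
have psiD : (bernstein n psi).[x] <= D.
  have -> : (bernstein n psi).[x] = e + c * (n%:R * x * (1 - x)).
    have := bernstein_lin n e c (fun=> 1) (fun k => (k%:R - n%:R * x) ^+ 2) x.
    rewrite bernstein_cst bernstein_sqr subrr expr0n addr0 mulr1 => <-.
    by congr (horner (bernstein _ _) _); apply/funext => k; rewrite mulr1.
  rewrite /D lerD2l.
  have -> : 2 * M * T ^+ 2 / (d ^+ 2 * n%:R) = c * n%:R.
    by rewrite /c; field; rewrite !gt_eqF.
  by case/andP: x01 => x0 x1; rewrite ler_wpM2l//; nra.
have -> : f t - (bernstein n phi).[x] = (bernstein n (fun k => f t - phi k)).[x].
  have := bernstein_lin n 1 (-1) (fun=> f t) phi x.
  rewrite bernstein_cst mul1r mulN1r => <-.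
  by congr (horner (bernstein _ _) _); apply/funext => k; ring.
rewrite ler_norml; apply/andP; split.
  have -> : - D = - 1 * D + 0 * 0 by ring.
  rewrite (@le_trans _ _ (bernstein n (fun k => -1 * psi k + 0 * 0)).[x])//.
    by rewrite (bernstein_lin _ _ _ psi (fun=> 0)) !mul0r !addr0 !mulN1r lerN2.
  apply: le_bernstein => // k kn; have [|] := cE k; last by rewrite ltnNge kn.
  by rewrite ler_norml mul0r addr0 mulN1r => /andP[].
apply: le_trans psiD; apply: le_bernstein => // k kn.
by have [/(le_trans (ler_norm _))//|] := cE k; rewrite ltnNge kn.
Qed.

End Bernstein.

(** * Legendre polynomials *)

Section PolynomialIntegrals.
Context {R : realType}.
Implicit Types (p q : {poly R}) (a b : R).

(** At index 0 the quotient is a division by 0, which has value 0, so the constant term vanishes. *)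
Definition primitive_poly p : {poly R} :=
  \poly_(i < (size p).+1) (p`_i.-1 / i%:R).

Lemma deriv_primitive_poly p : (primitive_poly p)^`() = p.
Proof.
apply/polyP => i; rewrite coef_deriv coef_poly ltnS.
case: ltnP => [ip|pi] /=; last by rewrite mul0rn nth_default.
by rewrite -[LHS]mulr_natr divfK// pnatr_eq0.
Qed.

Lemma integral_deriv_poly p a b : a <= b ->
  integral a b (horner p^`()) = p.[b] - p.[a].
Proof.
move=> ab; apply: integral_ftc2 => //; try exact: cont_horner.
by move=> x _; exact: is_derive_poly.
Qed.

Lemma integral_poly_parts p q a b : a <= b ->
  integral a b (horner (p * q^`())) =
  (p * q).[b] - (p * q).[a] - integral a b (horner (p^`() * q)).
Proof.
move=> ab; rewrite -integral_deriv_poly// -integralBc; try exact: cont_horner.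
by apply: eq_integral_cc => x _; rewrite derivM hornerD addrC addKr.
Qed.

(** If the integral were 0, so would be the integral up to each [t], because the integrand is
    nonnegative; then [p] would vanish throughout the open interval and have too many roots. *)
Lemma integral_poly_sqr_gt0 p a b : a < b -> p != 0 ->
  0 < integral a b (fun x => p.[x] ^+ 2).
Proof.
move=> ab p0.
have cp c d : cont c d (fun x => p.[x] ^+ 2) by apply: contX2; exact: cont_horner.
rewrite lt_def integral_sqr_ge0 andbT; apply/negP => /eqP I0.
have rp x : x \in `]a, b[ -> root p x.
  move=> xab; have := @integral_eq0_cont _ a b _ (ltW ab) (cp _ _) _ x xab.
  move=> /(_ _)/eqP; rewrite expf_eq0 /= => h; apply/h => t tab.
  move: (tab); rewrite in_itv /= => /andP[at_ tb].
  apply/eqP; rewrite eq_le integral_sqr_ge0 andbT -I0.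
  by rewrite (@integral_split _ a t b) ?at_ ?tb// lerDl integral_sqr_ge0.
(* Denominators start at 2 to keep these distinct points strictly between [a] and [b]. *)
pose rs := [seq a + (b - a) / k.+2%:R | k <- iota 0 (size p)].
have : (size rs < size p)%N.
  apply: max_poly_roots => //.
    apply/allP => _ /mapP[k _ ->]; apply: rp; rewrite in_itv /=.
    have k2 : 0 < k.+2%:R^-1 :> R by rewrite invr_gt0 ltr0n.
    have k21 : k.+2%:R^-1 < 1 :> R by rewrite invf_lt1 ?ltr0n// ltr1n.
    rewrite ltrDl mulr_gt0 ?subr_gt0//= -ltrBrDl gtr_pMr ?subr_gt0//.
  rewrite map_inj_uniq ?iota_uniq// => k l /addrI /mulfI.
  by rewrite subr_eq0 gt_eqF// => /(_ isT) /invr_inj /eqP; rewrite eqr_nat => /eqP[].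
by rewrite size_map size_iota ltnn.
Qed.

End PolynomialIntegrals.

(** * Degree, orthogonality and span of the Legendre polynomials *)

Section Legendre.
Context {R : realType}.
Implicit Types (p q : {poly R}) (T : R).

(** Each derivative costs one factor ['X - c], so [n - m] of them survive. *)
Lemma root_derivn_exp (c : R) q n m : (m < n)%N ->
  root (q * ('X - c%:P) ^+ n)^`(m) c.
Proof.
move=> mn; suff [g ->] : exists g, (q * ('X - c%:P) ^+ n)^`(m) =
    g * ('X - c%:P) ^+ (n - m).
  rewrite rootM; apply/orP; right.
  by rewrite -(subnSK mn) root_exp_XsubC eqxx.
elim: m mn => [|m IH] mn; first by exists q; rewrite subn0.
have [g gE] := IH (ltnW mn); rewrite derivnS gE derivM deriv_exp derivXsubC mul1r.
exists (g^`() * ('X - c%:P) + g *+ (n - m)).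
rewrite -(subnSK (ltnW mn)).
by rewrite exprS /= [RHS]mulrDl mulrA mulrnAl mulrnAr.
Qed.

Local Notation w i := (('X^2 - 1 : {poly R}) ^+ i).

Lemma monic_w i : w i \is monic.
Proof. by rewrite monic_exp// -[1]/(1%:P) monicXnsubC. Qed.

Lemma size_w i : size (w i) = (2 * i).+1.
Proof.
have := size_exp ('X^2 - 1 : {poly R}) i.
rewrite -[1]/(1%:P) size_XnsubC//= => <-.
by rewrite prednK// size_poly_gt0 monic_neq0// monic_w.
Qed.

Lemma size_legendre i : size (legendre i : {poly R}) = i.+1.
Proof.
have c0 : (2 ^+ i * i`!%:R : R)^-1 != 0.
  by rewrite invr_eq0 mulf_neq0 ?expf_neq0 ?pnatr_eq0// -lt0n fact_gt0.
rewrite /legendre size_scale//; apply/eqP; rewrite eqn_leq; apply/andP; split.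
  apply/leq_sizeP => j ij; rewrite coef_derivn nth_default ?mul0rn//.
  by rewrite size_w mulSn mul1n -addnS leq_add2l.
(* The coefficient of degree [i] is the leading coefficient 1 of [w i] times a nonzero falling
   factorial. *)
rewrite ltnNge; apply/negP => /leq_sizeP /(_ i (leqnn i)) /eqP.
rewrite coef_derivn -mulr_natr mulf_eq0 pnatr_eq0 -leqn0 leqNgt ffact_gt0 leq_addl orbF.
have /monicP := monic_w i; rewrite lead_coefE size_w /= mulSn mul1n => ->.
by rewrite oner_eq0.
Qed.

Lemma root_derivn_w i m (c : R) : (m < i)%N -> c ^+ 2 = 1 -> root (w i)^`(m) c.
Proof.
move=> mi c1.
have -> : w i = ('X + c%:P) ^+ i * ('X - c%:P) ^+ i.
  rewrite -exprMn mulrC -subr_sqr; congr ((_ - _) ^+ _).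
  by rewrite -[RHS]polyC_exp c1.
exact: root_derivn_exp.
Qed.

(** Integration by parts moves the [m] derivatives onto [q], which they annihilate. Boundary terms
    vanish because fewer than [i] derivatives of [w i] leave 1 and -1 as roots. *)
Lemma integral_mul_derivn_w i m q : (m <= i)%N -> (size q <= m)%N ->
  integral (-1) 1 (horner (q * (w i)^`(m))) = 0.
Proof.
have le11 : (-1 : R) <= 1 by lra.
elim: m q => [|m IH] q mi sq.
  move: sq; rewrite leqn0 size_poly_eq0 => /eqP ->; rewrite mul0r.
  by rewrite -[RHS](integral0c (-1) 1); apply: eq_integral_cc => x _; rewrite horner0.
rewrite derivnS integral_poly_parts// !hornerM.
rewrite (rootP (root_derivn_w mi (expr1n _ 2))).
rewrite (rootP (root_derivn_w mi _)); last by rewrite sqrrN expr1n.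
rewrite IH ?mulr0 ?subrr//; first exact: ltnW.
have [->|q0] := eqVneq q 0; first by rewrite deriv0 size_poly0.
by rewrite -ltnS (leq_trans _ sq)// lt_size_deriv.
Qed.

Lemma legendre_orthogonal i j : i != j ->
  integral (-1) 1 (horner (legendre i * legendre j : {poly R})) = 0.
Proof.
have main k l : (k < l)%N ->
    integral (-1) 1 (horner (legendre k * legendre l : {poly R})) = 0.
  move=> kl; rewrite {2}/legendre -scalerAr.
  rewrite (eq_integral_cc (g := fun x => (2 ^+ l * l`!%:R)^-1 *
    (legendre k * (w l)^`(l)).[x])); last by move=> x _; rewrite hornerZ.
  rewrite integralZc; last exact: cont_horner.
  by rewrite integral_mul_derivn_w ?mulr0// size_legendre.
by rewrite neq_ltn => /orP[/main//|/main]; rewrite mulrC.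
Qed.

Lemma legendre_neq0 i : legendre i != 0 :> {poly R}.
Proof. by rewrite -size_poly_gt0 size_legendre. Qed.

Let lt11 : (-1 : R) < 1. Proof. by lra. Qed.

Lemma legendreN_orthonormal i j :
  integral (-1) 1 (horner (legendreN i * legendreN j : {poly R})) = (i == j)%:R.
Proof.
pose c k := Num.sqrt (integral (-1) 1 (fun s => (legendre k : {poly R}).[s] ^+ 2)).
rewrite (eq_integral_cc (g := fun x => (c i)^-1 * (c j)^-1 *
    (legendre i * legendre j).[x])); last first.
  by move=> x _; rewrite /legendreN !hornerM !hornerZ /c; ring.
rewrite integralZc; last exact: cont_horner.
have [<-|ij] := eqVneq i j; last by rewrite legendre_orthogonal ?mulr0.
rewrite (eq_integral_cc (g := fun x => (legendre i).[x] ^+ 2)); last first.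
  by move=> x _; rewrite hornerM.
have I0 := integral_poly_sqr_gt0 lt11 (legendre_neq0 i).
rewrite -[X in _ * X](sqr_sqrtr (ltW I0)) -/(c i).
by have c0 : c i != 0 := lt0r_neq0 (etrans (sqrtr_gt0 _) I0); rewrite mulr1n; field.
Qed.

Lemma size_legendreN i : size (legendreN i : {poly R}) = i.+1.
Proof.
rewrite /legendreN size_scale ?size_legendre// invr_eq0 gt_eqF// sqrtr_gt0.
exact: integral_poly_sqr_gt0 lt11 (legendre_neq0 i).
Qed.

(** The degrees are exactly 0, 1, 2, and so on, so the leading term of [p] can be cancelled by the
    last basis element. *)
Lemma legendreN_span n p : (size p <= n)%N ->
  exists c : 'I_n -> R, p = \sum_(i < n) c i *: legendreN i.
Proof.
elim: n p => [|n IH] p sp.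
  exists (fun=> 0); move: sp; rewrite leqn0 size_poly_eq0 => /eqP ->.
  by rewrite big_ord0.
have l0 : lead_coef (legendreN n : {poly R}) != 0.
  by rewrite lead_coef_eq0 -size_poly_gt0 size_legendreN.
pose a := p`_n / lead_coef (legendreN n).
have [|c cE] := IH (p - a *: legendreN n).
  apply/leq_sizeP => j; rewrite leq_eqVlt => /predU1P[<-|nj].
    rewrite coefB coefZ /a lead_coefE size_legendreN /= divfK ?subrr//.
    by move: l0; rewrite lead_coefE size_legendreN.
  rewrite coefB coefZ !nth_default ?mulr0 ?subr0//; first by rewrite size_legendreN.
  exact: leq_trans sp nj.
exists (fun i => if unlift ord_max i is Some k then c k else a).
rewrite big_ord_recr /= unlift_none -[LHS](subrK (a *: legendreN n)) cE.
congr (_ + _); apply: eq_bigr => i _; congr (_ *: _).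
rewrite (_ : widen_ord _ i = lift ord_max i) ?liftK//.
by apply/val_inj; rewrite /= /bump leqNgt ltn_ord.
Qed.

Let to_unit T : {poly R} := (2 / T) *: 'X - 1.

Lemma horner_to_unit T t : 0 < T -> (to_unit T).[t] = (2 * t - T) / T.
Proof. by move=> T0; rewrite /to_unit !hornerE; field; rewrite gt_eqF. Qed.

Lemma shifted_legendreE T i t : 0 < T -> shifted_legendre T i t =
  (Num.sqrt (2 / T) *: (legendreN i \Po to_unit T)).[t].
Proof.
by move=> T0; rewrite hornerZ horner_comp horner_to_unit.
Qed.

Lemma cont_shifted_legendre T i a b : 0 < T -> cont a b (shifted_legendre T i).
Proof.
move=> T0.
apply: (@cont_eq _ a b (horner (Num.sqrt (2 / T) *: (legendreN i \Po to_unit T)))).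
  by move=> t _; rewrite shifted_legendreE.
exact: cont_horner.
Qed.

Lemma shifted_legendre_orthonormal T i j : 0 < T ->
  integral 0 T (fun t => shifted_legendre T i t * shifted_legendre T j t) =
  (i == j)%:R.
Proof.
move=> T0; have T2 : 0 <= 2 / T by rewrite divr_ge0// ltW.
(* The change of variable goes through a primitive: the chain rule produces the slope [2 / T] of
   [to_unit], which is the square of the normalizing factor. *)
pose P : {poly R} := primitive_poly (legendreN i * legendreN j).
rewrite (eq_integral_cc (g := horner (P \Po to_unit T)^`())); last first.
  move=> t _; rewrite !shifted_legendreE// !hornerZ deriv_comp deriv_primitive_poly.
  rewrite rmorphM /= !hornerM /to_unit derivB derivZ derivX derivC subr0 hornerZ hornerC.
  by rewrite mulr1 -[X in _ = _ * X](sqr_sqrtr T2); ring.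
rewrite integral_deriv_poly ?ltW// !horner_comp !horner_to_unit//.
rewrite mulr0 sub0r mulNr (_ : (2 * T - T) / T = 1); last by field; rewrite gt_eqF.
rewrite divff ?(gt_eqF T0)//; have := integral_deriv_poly P (ltW lt11).
by rewrite deriv_primitive_poly legendreN_orthonormal => ->.
Qed.

Lemma shifted_legendre_span T n p : 0 < T -> (size p <= n)%N ->
  exists c : 'I_n -> R, forall t, p.[t] = \sum_(i < n) c i * shifted_legendre T i t.
Proof.
move=> T0 sp; have T2 : Num.sqrt (2 / T) != 0 by rewrite gt_eqF ?sqrtr_gt0 ?divr_gt0.
pose from_unit : {poly R} := (T / 2) *: ('X + 1).
have sq : (size (p \Po from_unit) <= n)%N.
  have [->|p0] := eqVneq p 0; first by rewrite comp_poly0 size_poly0.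
  rewrite (leq_trans (size_comp_poly_leq _ _))//.
  rewrite size_scale ?gt_eqF ?divr_gt0// -[1]/(1%:P) size_XaddC muln1.
  by rewrite prednK// size_poly_gt0.
have [c cE] := legendreN_span sq.
exists (fun i => c i / Num.sqrt (2 / T)) => t.
have -> : p.[t] = (p \Po from_unit).[(to_unit T).[t]].
  rewrite horner_comp; congr horner; rewrite horner_to_unit// /from_unit !hornerE.
  by field; rewrite gt_eqF.
rewrite cE horner_sum; apply: eq_bigr => i _.
by rewrite hornerZ shifted_legendreE// [in RHS]hornerZ horner_comp mulrA divfK.
Qed.

End Legendre.

(** * Projections and Volterra operators *)

Section Projection.
Context {R : realType} (T : R) (T_gt0 : 0 < T).
Implicit Types (f g : R -> R) (n : nat).

Local Notation V := (shifted_legendre T).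
Local Notation cT f := (cont 0 T f).

Definition dot f g : R := integral 0 T (fun t => f t * g t).
Definition sqn f : R := integral 0 T (fun t => f t ^+ 2).
Definition comb n (c : 'I_n -> R) : R -> R := fun t => \sum_(i < n) c i * V i t.
Definition proj n f : R -> R := comb (fun i : 'I_n => dot f (V i)).
Definition defect n f : R -> R := fun t => f t - proj n f t.

Lemma cont_V i : cT (V i).
Proof. exact: cont_shifted_legendre. Qed.

Lemma cont_comb n (c : 'I_n -> R) : cT (comb c).
Proof. by apply: cont_sum => i; apply: contZ; exact: cont_V. Qed.

Lemma cont_proj n f : cT (proj n f).
Proof. exact: cont_comb. Qed.

Lemma cont_defect n f : cT f -> cT (defect n f).
Proof. by move=> cf; apply: contB => //; exact: cont_proj. Qed.

Lemma sqn_ge0 f : 0 <= sqn f.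
Proof. exact: integral_sqr_ge0. Qed.

Lemma sqnD f g : cT f -> cT g -> sqn (fun t => f t + g t) <= 2 * sqn f + 2 * sqn g.
Proof.
move=> cf cg; rewrite -!integralZc; try exact: contX2.
rewrite -integralDc; try by apply: contZ; exact: contX2.
apply: le_integralc; first by apply: contX2; exact: contD.
  by apply: contD; apply: contZ; exact: contX2.
by move=> t _; have := sqr_ge0 (f t - g t); nra.
Qed.

Lemma sqnZ (k : R) f : cT f -> sqn (fun t => k * f t) = k ^+ 2 * sqn f.
Proof.
move=> cf; rewrite -integralZc; last exact: contX2.
by apply: eq_integral_cc => t _; rewrite exprMn.
Qed.

Lemma eq_sqn f g : {in `[0, T], f =1 g} -> sqn f = sqn g.
Proof. by move=> fg; apply: eq_integral_cc => t /fg ->. Qed.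

Lemma dotC f g : dot f g = dot g f.
Proof. by apply: eq_integral_cc => t _; rewrite mulrC. Qed.

Lemma dotDl f g h : cT f -> cT g -> cT h ->
  dot (fun t => f t + g t) h = dot f h + dot g h.
Proof.
move=> cf cg ch; rewrite -integralDc; try exact: contM.
by apply: eq_integral_cc => t _; rewrite mulrDl.
Qed.

Lemma dotBl f g h : cT f -> cT g -> cT h ->
  dot (fun t => f t - g t) h = dot f h - dot g h.
Proof.
move=> cf cg ch; rewrite -integralBc; try exact: contM.
by apply: eq_integral_cc => t _; rewrite mulrBl.
Qed.

Lemma dotZl (k : R) f h : cT f -> cT h -> dot (fun t => k * f t) h = k * dot f h.
Proof.
move=> cf ch; rewrite -integralZc; last exact: contM.
by apply: eq_integral_cc => t _; rewrite mulrA.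
Qed.

Lemma dot_suml n (F : 'I_n -> R -> R) h : (forall i, cT (F i)) -> cT h ->
  dot (fun t => \sum_(i < n) F i t) h = \sum_(i < n) dot (F i) h.
Proof.
move=> cF ch; rewrite -integral_sumc => [|i]; last exact: contM.
by apply: eq_integral_cc => t _; rewrite mulr_suml.
Qed.

Lemma eq_dot f f' g : {in `[0, T], f =1 f'} -> dot f g = dot f' g.
Proof. by move=> ff; apply: eq_integral_cc => t /ff ->. Qed.

Lemma dot_combl n (c : 'I_n -> R) h : cT h ->
  dot (comb c) h = \sum_(i < n) c i * dot (V i) h.
Proof.
move=> ch; rewrite dot_suml// => [|i]; last by apply: contZ; exact: cont_V.
by apply: eq_bigr => i _; rewrite dotZl//; exact: cont_V.
Qed.

Lemma dot_comb_V n (c : 'I_n -> R) (j : 'I_n) : dot (comb c) (V j) = c j.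
Proof.
rewrite dot_combl; last exact: cont_V.
rewrite (bigD1 j)//= big1 ?addr0 => [|i ij]; rewrite /dot shifted_legendre_orthonormal//.
  by rewrite eqxx mulr1.
by move/negPf : ij; rewrite -val_eqE /= => ->; rewrite mulr0.
Qed.

Lemma sqn_comb n (c : 'I_n -> R) : sqn (comb c) = \sum_(i < n) c i ^+ 2.
Proof.
rewrite (_ : sqn _ = dot (comb c) (comb c)) // dot_combl; last exact: cont_comb.
by apply: eq_bigr => i _; rewrite dotC dot_comb_V.
Qed.

(** Completing the square in each coefficient, by orthonormality. Bessel's inequality and the
    optimality of the projection are both read off this identity. *)
Lemma sqn_sub_comb n (c : 'I_n -> R) f : cT f ->
  sqn (fun t => f t - comb c t) =
  sqn f - \sum_(i < n) dot f (V i) ^+ 2 + \sum_(i < n) (c i - dot f (V i)) ^+ 2.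
Proof.
move=> cf; have cc := @cont_comb n c.
have -> : sqn (fun t => f t - comb c t) =
    sqn f - 2 * dot (comb c) f + sqn (comb c).
  rewrite /sqn /dot -integralZc; last exact: contM.
  rewrite -integralBc; [|exact: contX2|by apply: contZ; exact: contM].
  rewrite -integralDc; [|apply: contB; [exact: contX2|]|exact: contX2].
    by apply: eq_integral_cc => t _; ring.
  by apply: contZ; exact: contM.
rewrite sqn_comb dot_combl// -!addrA; congr (_ + _).
rewrite mulr_sumr -!sumrN -!big_split /=; apply: eq_bigr => i _.
by rewrite (dotC f); ring.
Qed.

Lemma sqn_proj_le n f : cT f -> sqn (proj n f) <= sqn f.
Proof.
move=> cf; rewrite sqn_comb -subr_ge0.
have := sqn_sub_comb (fun i : 'I_n => dot f (V i)) cf.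
rewrite [X in _ + X]big1 ?addr0 => [<-|i _]; first exact: sqn_ge0.
by rewrite subrr expr0n.
Qed.

Lemma sqn_defect_best n f (c : 'I_n -> R) : cT f ->
  sqn (defect n f) <= sqn (fun t => f t - comb c t).
Proof.
move=> cf; rewrite !sqn_sub_comb// lerD2l [X in X <= _]big1 => [|i _].
  by apply: sumr_ge0 => i _; exact: sqr_ge0.
by rewrite subrr expr0n.
Qed.

Lemma sqn_defect_le n f : cT f -> sqn (defect n f) <= sqn f.
Proof.
move=> cf; apply: le_trans (sqn_defect_best (fun i : 'I_n => 0) cf) _.
rewrite le_eqVlt; apply/orP; left; apply/eqP/eq_sqn => t _.
by rewrite /comb big1 ?subr0// => i _; rewrite mul0r.
Qed.

Lemma projD n f g : cT f -> cT g ->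
  proj n (fun t => f t + g t) = fun t => proj n f t + proj n g t.
Proof.
move=> cf cg; apply/funext => t; rewrite /proj /comb -big_split /=.
by apply: eq_bigr => i _; rewrite dotDl// ?mulrDl//; exact: cont_V.
Qed.

Lemma projB n f g : cT f -> cT g ->
  proj n (fun t => f t - g t) = fun t => proj n f t - proj n g t.
Proof.
move=> cf cg; apply/funext => t; rewrite /proj /comb -sumrB.
by apply: eq_bigr => i _; rewrite dotBl// ?mulrBl//; exact: cont_V.
Qed.

Lemma defectD n f g : cT f -> cT g ->
  defect n (fun t => f t + g t) = fun t => defect n f t + defect n g t.
Proof. by move=> cf cg; apply/funext => t; rewrite /defect projD//; ring. Qed.

Lemma eq_proj n f g : {in `[0, T], f =1 g} -> proj n f = proj n g.
Proof.
move=> fg; apply/funext => t; apply: eq_bigr => i _.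
by rewrite (eq_dot _ fg).
Qed.

End Projection.

(** * Volterra operators: equicontinuity and polynomial approximation *)

Section Volterra.
Context {R : realType} (T : R) (T_gt0 : 0 < T).
Implicit Types (e f : R -> R) (k : R -> R -> R) (t : R).

Local Notation cT f := (cont 0 T f).
Local Notation sqn := (sqn T).
Let T_ge0 := ltW T_gt0.

Definition volterra k e t : R := integral 0 t (fun s => k t s * e s).

Lemma cont_volterra_integrand k e t : continuous_on_triangle T k -> cT e ->
  t \in `[0, T] -> cont 0 t (fun s => k t s * e s).
Proof.
move=> ck ce tT; apply: contM; first exact: kernel_row ck.
by apply: cont_sub ce => //; move: tT; rewrite in_itv => /andP[].
Qed.


Lemma integral_bounded_sqr a b (M : R) f e : a <= b -> 0 <= M ->
  cont a b f -> cont a b e -> {in `[a, b], forall s, `|f s| <= M} ->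
  integral a b (fun s => f s * e s) ^+ 2 <=
  M ^+ 2 * (b - a) * integral a b (fun s => e s ^+ 2).
Proof.
move=> ab M0 cf ce fM; apply: le_trans (cauchy_schwarz cf ce) _.
apply: ler_wpM2r; first exact: integral_sqr_ge0.
rewrite -integral_cstc//; apply: le_integralc; [exact: contX2|exact: cont_cst|].
move=> s /fM; rewrite -[f s ^+ 2]real_normK ?num_real// => fsM.
by rewrite lerXn2r ?nnegrE.
Qed.

Lemma integral_sqr_sub e a b : cT e -> 0 <= a -> a <= b -> b <= T ->
  integral a b (fun s => e s ^+ 2) <= sqn e.
Proof.
move=> ce a0 ab bT; have cX : cT (fun s => e s ^+ 2) by exact: contX2.
have c0b : cont 0 b (fun s => e s ^+ 2) by exact: cont_sub cX.
rewrite /sqn (@integral_split _ 0 b T) ?bT ?(le_trans a0)//.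
rewrite (@integral_split _ 0 a b) ?a0// addrAC lerDr.
by rewrite addr_ge0// integral_sqr_ge0.
Qed.

(** The integral on the right stops at [t] instead of [T]; Gronwall's inequality needs this causal
    form. *)
Lemma volterra_sqr k e t (M : R) : continuous_on_triangle T k -> cT e ->
  0 <= M -> (forall t s, triangle T (t, s) -> `|k t s| <= M) ->
  t \in `[0, T] ->
  volterra k e t ^+ 2 <= M ^+ 2 * T * integral 0 t (fun s => e s ^+ 2).
Proof.
move=> ck ce M0 kM tT; have := tT; rewrite in_itv /= => /andP[t0 tT'].
apply: le_trans (integral_bounded_sqr t0 M0 (kernel_row tT ck) _ _) _.
- exact: cont_sub ce.
- by move=> s; rewrite in_itv /= => ?; apply: kM.
- rewrite subr0 ler_wpM2r ?integral_sqr_ge0// ler_wpM2l// sqr_ge0//.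
Qed.

(** The increment splits into the variation of the kernel over [[0, t]] and a tail over [[t, t']].
    Cauchy-Schwarz makes each square at most [eta / 4] times [sqn e], and the square of a difference
    is at most twice the sum of the squares. *)
Lemma volterra_equicontinuous k : continuous_on_triangle T k ->
  forall eta : R, 0 < eta -> exists2 d : R, 0 < d &
    forall e, cT e -> {in `[0, T] &, forall t t', `|t - t'| < d ->
      (volterra k e t - volterra k e t') ^+ 2 <= eta * sqn e}.
Proof.
move=> ck eta eta0.
have [M M0 kM] := kernel_bound T_ge0 ck.
have w0 : 0 < Num.sqrt (eta / (4 * T)) by rewrite sqrtr_gt0 divr_gt0// mulr_gt0.
have [d d0 kd] := kernel_unif T_ge0 ck w0.
have d1 : 0 < eta / (4 * M ^+ 2) by rewrite divr_gt0// mulr_gt0// exprn_gt0.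
exists (Num.min d (eta / (4 * M ^+ 2))); first by rewrite lt_min d0.
move=> e ce.
suff main t t' : t \in `[0, T] -> t' \in `[0, T] -> t <= t' ->
    `|t - t'| < Num.min d (eta / (4 * M ^+ 2)) ->
    (volterra k e t - volterra k e t') ^+ 2 <= eta * sqn e.
  move=> t t' tT t'T dtt; have [tt|/ltW tt] := leP t t'; first exact: main.
  by rewrite -sqrrN opprB; apply: main => //; rewrite distrC.
move=> tT t'T tt; rewrite lt_min distrC ger0_norm ?subr_ge0// => /andP[dtt dtt'].
have := tT; have := t'T; rewrite !in_itv /= => /andP[t'0 t'T'] /andP[t0 tT'].
have ckt := cont_volterra_integrand ck ce tT.
have ckt' := cont_volterra_integrand ck ce t'T.
have ckt't : cont 0 t (fun s => k t' s * e s) by exact: cont_sub ckt'.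
have ckt't' : cont t t' (fun s => k t' s * e s) by exact: cont_sub ckt'.
have ce0t : cont 0 t e by exact: cont_sub ce.
have kt' : cont 0 t (k t') by apply: cont_sub (kernel_row t'T ck).
have -> : volterra k e t - volterra k e t' =
    integral 0 t (fun s => (k t s - k t' s) * e s) -
    integral t t' (fun s => k t' s * e s).
  rewrite /volterra (@integral_split _ 0 t t') ?t0//.
  rewrite opprD addrA -integralBc//; congr (_ - _).
  by apply: eq_integral_cc => s _; rewrite mulrBl.
have I1 : integral 0 t (fun s => (k t s - k t' s) * e s) ^+ 2 <= eta / 4 * sqn e.
  apply: le_trans (integral_bounded_sqr t0 (ltW w0) _ ce0t _) _.
  - by apply: contB => //; exact: kernel_row ck.
  - move=> s; rewrite in_itv /= => /andP[s0 st]; apply/ltW/kd.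
    + by rewrite /triangle /= s0 st.
    + by rewrite /triangle /= s0 (le_trans st).
    + by rewrite distrC ger0_norm ?subr_ge0.
    + by rewrite subrr normr0.
  rewrite sqr_sqrtr ?divr_ge0 ?mulr_ge0 ?(ltW eta0)// subr0.
  apply: ler_pM; rewrite ?integral_sqr_ge0//.
  - by rewrite mulr_ge0// divr_ge0 ?mulr_ge0 ?(ltW eta0).
  - have -> : eta / 4 = eta / (4 * T) * T by field; rewrite gt_eqF.
    by rewrite ler_wpM2l// divr_ge0 ?mulr_ge0 ?(ltW eta0).
  - exact: integral_sqr_sub.
have I2 : integral t t' (fun s => k t' s * e s) ^+ 2 <= eta / 4 * sqn e.
  apply: le_trans (integral_bounded_sqr tt (ltW M0) _ _ _) _.
  - by apply: cont_sub (kernel_row t'T ck).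
  - exact: cont_sub ce.
  - move=> s; rewrite in_itv /= => /andP[s0 st]; apply/kM.
    by rewrite /triangle /= st (le_trans t0).
  apply: ler_pM; rewrite ?integral_sqr_ge0//.
  - by rewrite mulr_ge0 ?sqr_ge0// subr_ge0.
  - have -> : eta / 4 = M ^+ 2 * (eta / (4 * M ^+ 2)) by field; rewrite gt_eqF.
    by rewrite ler_wpM2l ?sqr_ge0// ltW.
  - exact: integral_sqr_sub.
move: I1 I2; set A := integral 0 t _; set B := integral t t' _ => I1 I2.
by have := sqr_ge0 (A + B); nra.
Qed.

Lemma cont_volterra k e : continuous_on_triangle T k -> cT e -> cT (volterra k e).
Proof.
move=> ck ce; apply/subspace_continuousP => t tT.
apply/cvgrPdist_lt => eps eps0.
have eta0 : 0 < eps ^+ 2 / (sqn e + 1) / 2.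
  by rewrite !divr_gt0// ?exprn_gt0// ltr_wpDl// sqn_ge0.
have [d d0 dP] := volterra_equicontinuous ck eta0.
rewrite /prop_near1 nbhs_simpl /= /within /=; apply/nbhs_ballP; exists d => //= s ts sT.
have /= := dP e ce _ _ tT sT ts.
have /= sq0 := sqn_ge0 T e.
have : eps ^+ 2 / (sqn e + 1) / 2 * sqn e < eps ^+ 2.
  rewrite mulrAC ltr_pdivrMr// mulrAC ltr_pdivrMr ?ltr_wpDl//.
  have : 0 < eps ^+ 2 by rewrite exprn_gt0.
  by nra.
move=> /[swap] /le_lt_trans /[apply] h.
rewrite -(ltr_pXn2r (n := 2)) ?nnegrE ?(ltW eps0)//.
by rewrite real_normK ?num_real.
Qed.

(* The unit ball is mapped by a Volterra operator into an equicontinuous set,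
   so Bernstein polynomials of one fixed degree approximate the whole image. *)
Lemma defect_volterra k : continuous_on_triangle T k ->
  forall eta : R, 0 < eta -> exists N : nat, forall n e, (N <= n)%N -> cT e ->
    sqn (defect T n (volterra k e)) <= eta * sqn e.
Proof.
move=> ck eta eta0.
have [M M0 kM] := kernel_bound T_ge0 ck.
pose h := Num.sqrt (eta / (4 * T)).
have h2 : h ^+ 2 = eta / (4 * T).
  by rewrite sqr_sqrtr// divr_ge0 ?mulr_ge0 ?(ltW eta0).
have h0 : 0 < h by rewrite sqrtr_gt0 divr_gt0// mulr_gt0.
have [d d0 kd] := volterra_equicontinuous ck (exprn_gt0 2 h0).
pose L := Num.sqrt (M ^+ 2 * T).
(* At degree [m.+1] the variance term of the Bernstein error drops below [h * r], so the total error
   is at most [2 * (h * r)]; the square of this times [T] is [eta * sqn e]. A polynomial of that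
   degree has size at most [m.+2], hence the threshold. *)
pose m := Num.bound (2 * L * T ^+ 2 / d ^+ 2 / h).
exists m.+2 => n e mn ce.
pose r := Num.sqrt (sqn e).
have r2 : r ^+ 2 = sqn e by rewrite sqr_sqrtr// sqn_ge0.
have r0 : 0 <= r by exact: sqrtr_ge0.
have L2 : L ^+ 2 = M ^+ 2 * T by rewrite sqr_sqrtr// mulr_ge0 ?sqr_ge0.
have L0 : 0 <= L by exact: sqrtr_ge0.
have sqr_le x y : 0 <= y -> x ^+ 2 <= y ^+ 2 -> `|x| <= y :> R.
  move=> y0 xy; rewrite -(ler_pXn2r (n := 2)) ?nnegrE//.
  by rewrite real_normK ?num_real.
have bnd : {in `[0, T], forall t, `|volterra k e t| <= L * r}.
  move=> t tT; apply: sqr_le; first exact: mulr_ge0.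
  apply: le_trans (volterra_sqr ck ce (ltW M0) kM tT) _.
  rewrite exprMn L2 r2; apply: ler_wpM2l; first by apply: mulr_ge0; rewrite ?sqr_ge0.
  by move: tT; rewrite in_itv /= => /andP[? ?]; exact: integral_sqr_sub.
have mod : {in `[0, T] &, forall t s, `|t - s| < d ->
    `|volterra k e t - volterra k e s| <= h * r}.
  move=> t s tT sT ts; apply: sqr_le; first by rewrite mulr_ge0// ltW.
  by rewrite exprMn r2; exact: kd.
have hr0 : 0 <= h * r by rewrite mulr_ge0// ltW.
have [p sp pP] := bernstein_approx T_gt0 hr0 d0 (ltn0Sn m) bnd mod.
have [c cE] := shifted_legendre_span T_gt0 (leq_trans sp mn).
have cv := cont_volterra ck ce.
apply: le_trans (sqn_defect_best T_gt0 c cv) _.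
have -> : eta * sqn e = (2 * (h * r)) ^+ 2 * (T - 0).
  by rewrite !exprMn h2 r2; field; rewrite gt_eqF.
rewrite -integral_cstc//; apply: le_integralc; last 1 first.
- move=> t tT; rewrite -[leLHS]real_normK ?num_real//.
  rewrite lerXn2r ?nnegrE//; first exact: mulr_ge0.
  have -> : comb T c t = p.[t] by rewrite cE.
  apply: le_trans (pP t tT) _.
  rewrite (_ : 2 * (h * r) = h * r + h * r) ?lerD2l; last by ring.
  have -> : 2 * (L * r) * T ^+ 2 / (d ^+ 2 * m.+1%:R) =
      2 * L * T ^+ 2 / d ^+ 2 / m.+1%:R * r.
    by field; rewrite !gt_eqF// ltr0n.
  rewrite ler_wpM2r// ler_pdivrMr ?ltr0n// [leRHS]mulrC -ler_pdivrMr//.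
  have X0 : 0 <= 2 * L * T ^+ 2 / d ^+ 2 / h.
    by do ![apply: sqr_ge0 | exact: ltW | apply: divr_ge0 | apply: mulr_ge0 => //].
  apply/ltW/(lt_trans (archi_boundP X0)); rewrite -/m.
  by rewrite ltr_nat.
- by apply: contX2; apply: contB => //; exact: cont_comb.
- exact: cont_cst.
Qed.

Definition volterra_pair k l x y t : R := volterra k x t + volterra l y t.

Lemma cont_volterra_pair k l x y : continuous_on_triangle T k ->
  continuous_on_triangle T l -> cT x -> cT y -> cT (volterra_pair k l x y).
Proof. by move=> ck cl cx cy; apply: contD; exact: cont_volterra. Qed.

End Volterra.

(** * Stability of the projected system *)

Section SecondKindSystem.
Context {R : realType} (T : R) (T_gt0 : 0 < T).
Context (k11 k12 k21 k22 : R -> R -> R) (m : R -> R).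
Context (ck11 : continuous_on_triangle T k11) (ck12 : continuous_on_triangle T k12).
Context (ck21 : continuous_on_triangle T k21) (ck22 : continuous_on_triangle T k22).
Context (cm : cont 0 T m).
Implicit Types (x y r g : R -> R) (n : nat).

Local Notation cT f := (cont 0 T f).
Local Notation sqn := (sqn T).
Local Notation proj := (proj T).
Local Notation defect := (defect T).
Let T_ge0 : 0 <= T := ltW T_gt0.

Local Notation op1 := (volterra_pair k11 k12).
Local Notation op2 := (volterra_pair k21 k22).

Lemma volterra_sqr_le k : continuous_on_triangle T k ->
  exists2 A : R, 0 <= A & forall e, cT e -> {in `[0, T], forall t,
    volterra k e t ^+ 2 <= A * integral 0 t (fun s => e s ^+ 2)}.
Proof.
move=> ck; have [M M0 kM] := kernel_bound T_ge0 ck.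
exists (M ^+ 2 * T); first by rewrite mulr_ge0// sqr_ge0.
by move=> e ce t tT; exact: volterra_sqr ck ce (ltW M0) kM tT.
Qed.

Lemma op_sqr_le k l : continuous_on_triangle T k -> continuous_on_triangle T l ->
  exists2 A : R, 0 <= A & forall x y, cT x -> cT y -> {in `[0, T], forall t,
    (volterra k x t + volterra l y t) ^+ 2 <=
    A * integral 0 t (fun s => x s ^+ 2 + y s ^+ 2)}.
Proof.
move=> ck cl; have [A A0 AP] := volterra_sqr_le ck; have [B B0 BP] := volterra_sqr_le cl.
exists (2 * (A + B)); first by rewrite mulr_ge0// addr_ge0.
move=> x y cx cy t tT; have := tT; rewrite in_itv /= => /andP[t0 tT'].
have cx2 : cont 0 t (fun s => x s ^+ 2) by apply/contX2; exact: cont_sub cx.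
have cy2 : cont 0 t (fun s => y s ^+ 2) by apply/contX2; exact: cont_sub cy.
rewrite integralDc//.
have := AP x cx t tT; have := BP y cy t tT.
have := integral_sqr_ge0 0 t x; have := integral_sqr_ge0 0 t y.
set X := integral _ _ (fun s => x s ^+ 2); set Y := integral _ _ (fun s => y s ^+ 2).
have := sqr_ge0 (volterra k x t - volterra l y t).
have := mulr_ge0 A0 (integral_sqr_ge0 0 t y).
have := mulr_ge0 B0 (integral_sqr_ge0 0 t x).
rewrite -/X -/Y; nra.
Qed.

(* The multiplication [m] is not compact, but it only feeds the first component
   into the second one: eliminating it leaves a Gronwall inequality. *)
Lemma system_gronwall : exists2 C : R, 0 < C &
  forall x y, cT x -> cT y ->
    sqn x + sqn y <= C * (sqn (fun t => x t - op1 x y t) +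
                          sqn (fun t => y t - (m t * x t + op2 x y t))).
Proof.
have [A A0 AP] := op_sqr_le ck11 ck12; have [A' A'0 AP'] := op_sqr_le ck21 ck22.
have [B B0 BP] := cont_bound T_ge0 cm.
(* [c] and [D] collect, with some slack, the coefficients of [W] and of the squared residuals in
   [x2], [y2] and [mx2] below. *)
pose c := 4 * A + 2 * A * 2 * B ^+ 2 + 4 * A'.
pose D := 4 + 4 * B ^+ 2.
have c0 : 0 <= c.
  have := mulr_ge0 A0 (sqr_ge0 B); rewrite /c; lra.
have D0 : 0 < D by have := sqr_ge0 B; rewrite /D; lra.
exists (expR (c * T) * D); first by rewrite mulr_gt0// expR_gt0.
move=> x y cx cy.
have c1 : cT (fun t => x t - op1 x y t) by apply: contB => //; exact: cont_volterra_pair.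
have c2 : cT (fun t => y t - (m t * x t + op2 x y t)).
  by apply: contB => //; apply: contD; [exact: contM|exact: cont_volterra_pair].
pose r t := D * ((x t - op1 x y t) ^+ 2 + (y t - (m t * x t + op2 x y t)) ^+ 2).
have cr : cT r by apply: contZ; apply: contD; exact: contX2.
have cw : cT (fun t => x t ^+ 2 + y t ^+ 2) by apply: contD; exact: contX2.
rewrite -mulrA -!integralDc; try exact: contX2.
rewrite -integralZc; last by apply: contD; exact: contX2.
apply: gronwall => //.
  by move=> t _; apply: mulr_ge0; [exact: ltW|apply: addr_ge0; exact: sqr_ge0].
move=> t tT; rewrite /r /c /D.
have := AP x y cx cy t tT; have := AP' x y cx cy t tT; have := BP t tT.
rewrite -/(op1 x y t) -/(op2 x y t).
set W := integral _ _ _; set h := op1 x y t; set g := op2 x y t.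
move=> mB gW hW.
have W0 : 0 <= W by apply: integral_ge0c => s _; rewrite addr_ge0 ?sqr_ge0.
set rho := x t - h; set sig := y t - _.
have mB2 : m t ^+ 2 <= B ^+ 2.
  by rewrite -[m t ^+ 2]real_normK ?num_real// lerXn2r ?nnegrE ?(ltW B0).
have xE : x t = h + rho by rewrite /rho; ring.
have yE : y t = m t * x t + g + sig by rewrite /sig; ring.
have x2 : x t ^+ 2 <= 2 * A * W + 2 * rho ^+ 2.
  by rewrite xE; have := sqr_ge0 (h - rho); nra.
have y2 : y t ^+ 2 <= 2 * (m t ^+ 2 * x t ^+ 2) + 4 * A' * W + 4 * sig ^+ 2.
  rewrite yE; have := sqr_ge0 (m t * x t - (g + sig)); have := sqr_ge0 (g - sig).
  nra.
have mx2 : m t ^+ 2 * x t ^+ 2 <= B ^+ 2 * (2 * A * W + 2 * rho ^+ 2).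
  by apply: ler_pM; rewrite ?sqr_ge0.
have := mulr_ge0 A0 W0; have := sqr_ge0 rho; have := sqr_ge0 sig.
have := mulr_ge0 (sqr_ge0 B) (sqr_ge0 sig).
by lra.
Qed.

Lemma defect_op k l : continuous_on_triangle T k -> continuous_on_triangle T l ->
  forall eta : R, 0 < eta -> exists N : nat, forall n x y, (N <= n)%N ->
    cT x -> cT y ->
    sqn (defect n (fun t => volterra k x t + volterra l y t)) <=
    eta * (sqn x + sqn y).
Proof.
move=> ck cl eta eta0; have eta2 : 0 < eta / 2 by rewrite divr_gt0.
have [N1 N1P] := defect_volterra T_gt0 ck eta2.
have [N2 N2P] := defect_volterra T_gt0 cl eta2.
exists (maxn N1 N2) => n x y; rewrite geq_max => /andP[n1 n2] cx cy.
rewrite defectD//; try exact: cont_volterra.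
apply: le_trans (sqnD _ _) _; try by apply: cont_defect => //; exact: cont_volterra.
have aux (X Y u v : R) : u <= eta / 2 * X -> v <= eta / 2 * Y ->
    2 * u + 2 * v <= eta * (X + Y) by lra.
exact: aux (N1P n x n1 cx) (N2P n y n2 cy).
Qed.

Lemma galerkin_stability : exists2 C : R, 0 < C & exists N : nat,
  forall n x y r1 r2, (N <= n)%N -> cT x -> cT y -> cT r1 -> cT r2 ->
    {in `[0, T], forall t, x t = proj n (op1 x y) t + r1 t} ->
    {in `[0, T], forall t,
      y t = proj n (fun s => m s * x s + op2 x y s) t + r2 t} ->
    sqn x + sqn y <= C * (sqn r1 + sqn r2).
Proof.
have [E E0 EP] := system_gronwall.
have [b b0 bP] := cont_bound T_ge0 cm.
pose B := b ^+ 2; have B0 : 0 <= B by exact: sqr_ge0.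
(* The bounds below add up to [eta * (14 + 16 * B) * S]: [2 + 16 * B] comes through [rho] and 12
   from [sig] directly. After multiplication by [E] this is half of [S], which is absorbed. *)
pose eta := (2 * E * (14 + 16 * B))^-1.
have den0 : 0 < 2 * E * (14 + 16 * B) by rewrite !mulr_gt0//; lra.
have eta0 : 0 < eta by rewrite invr_gt0.
have [N1 N1P] := defect_op ck11 ck12 eta0.
have [N2 N2P] := defect_op ck21 ck22 eta0.
(* These are the kernels of [m * op1]: a factor depending on [t] alone can enter the kernel. *)
have [N3 N3P] := defect_op (kernelM cm ck11) (kernelM cm ck12) eta0.
exists (2 * E * (2 + 16 * B)); first by rewrite !mulr_gt0//; lra.
exists (maxn N1 (maxn N2 N3)) => n x y r1 r2.
rewrite !geq_max => /and3P[n1 n2 n3] cx cy cr1 cr2 xE yE.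
have ch := cont_volterra_pair T_gt0 ck11 ck12 cx cy.
have cg := cont_volterra_pair T_gt0 ck21 ck22 cx cy.
have cmx : cT (fun t => m t * x t) by exact: contM.
have cmh : cT (fun t => m t * op1 x y t) by exact: contM.
pose rho t := x t - op1 x y t.
have crho : cT rho by exact: contB.
have cmrho : cT (fun t => m t * rho t) by exact: contM.
have := EP x y cx cy; rewrite -/rho.
set S := sqn x + sqn y; set sig := (fun t => y t - _).
have S0 : 0 <= S by rewrite addr_ge0 ?sqn_ge0.
(* As [x] is the projection of [op1 x y] plus [r1], [rho] is [r1] minus the defect of [op1 x y]. *)
have Qrho : sqn rho <= 2 * sqn r1 + 2 * (eta * S).
  rewrite (@eq_sqn _ _ rho (fun t => r1 t + (-1) * defect n (op1 x y) t)).
    apply: le_trans (sqnD _ _) _ => //; first by apply: contZ; exact: cont_defect.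
    rewrite sqnZ ?sqrrN ?expr1n ?mul1r; last exact: cont_defect.
    by rewrite lerD2l ler_pM2l//; exact: N1P.
  by move=> t tT; rewrite /rho xE// /defect; ring.
have Qmh : sqn (defect n (fun t => m t * op1 x y t)) <= eta * S.
  apply: le_trans (N3P n x y n3 cx cy); rewrite le_eqVlt; apply/orP; left.
  apply/eqP/eq_sqn => t tT.
  have eqm : {in `[0, T], (fun s => m s * op1 x y s) =1 (fun s =>
      volterra (fun t s => m t * k11 t s) x s + volterra (fun t s => m t * k12 t s) y s)}.
    move=> s sT; rewrite /volterra_pair /volterra mulrDr.
    rewrite -!integralZc; try exact: cont_volterra_integrand.
    by congr (_ + _); apply: eq_integral_cc => z _; rewrite mulrA.
  by rewrite /defect (eq_proj _ eqm) eqm.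
have Qmrho : sqn (fun t => m t * rho t) <= B * sqn rho.
  rewrite -integralZc; last exact: contX2.
  apply: le_integralc; [exact: contX2|by apply: contZ; exact: contX2|].
  move=> t tT; rewrite exprMn ler_wpM2r ?sqr_ge0//.
  by rewrite -[leLHS]real_normK ?num_real// lerXn2r ?nnegrE ?bP// ltW.
(* On [m * rho] taking the defect gains nothing beyond norm at most 1; the smallness is that of
   [rho] itself. *)
have Qmx : sqn (defect n (fun t => m t * x t)) <= 2 * (eta * S) + 2 * (B * sqn rho).
  have -> : (fun t => m t * x t) = fun t => m t * op1 x y t + m t * rho t.
    by apply/funext => t; rewrite /rho; ring.
  rewrite defectD//; apply: le_trans (sqnD _ _) _; try exact: cont_defect.
  rewrite lerD// ler_pM2l//.
  by apply: le_trans (sqn_defect_le _ _ _) Qmrho.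
have Qsig : sqn sig <= 2 * sqn r2 + 4 * (2 * (eta * S) + 2 * (B * sqn rho)) + 4 * (eta * S).
  rewrite (@eq_sqn _ _ sig (fun t => r2 t +
      (-1) * (defect n (fun s => m s * x s) t + defect n (op2 x y) t))).
    have cd : cT (fun t => defect n (fun s => m s * x s) t + defect n (op2 x y) t).
      by apply: contD; exact: cont_defect.
    apply: le_trans (sqnD _ _) _ => //; first exact: contZ.
    rewrite sqnZ ?sqrrN ?expr1n ?mul1r// -addrA lerD2l.
    have := sqnD (cont_defect T_gt0 (n := n) cmx) (cont_defect T_gt0 (n := n) cg).
    have := N2P n x y n2 cx cy; rewrite -/(op2 x y) -/S.
    move: Qmx; set q := sqn _; set q' := sqn _; set q'' := sqn _; set z := sqn rho.
    by move=> h1 h2 h3; lra.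
  move=> t tT; rewrite /sig yE// projD// /defect; ring.
have q1 := sqn_ge0 T r1; have q2 := sqn_ge0 T r2.
have etaE : E * (eta * (14 + 16 * B)) = 2^-1.
  have aux (u v : R) : 0 < u -> 0 < v -> u * ((2 * u * v)^-1 * v) = 2^-1.
    by move=> u0 v0; field; rewrite !gt_eqF.
  by apply: aux => //; rewrite ltr_wpDr// mulr_ge0.
move: Qsig Qrho q1 q2; clear -E0 B0 S0 etaE.
set w := sqn sig; set z := sqn rho; set s1 := sqn r1; set s2 := sqn r2.
move: S w z s1 s2 S0 => S w z s1 s2 S0 Qsig Qrho q1 q2 SE.
have {}SE : S <= E * ((2 + 16 * B) * s1 + 2 * s2 + eta * (14 + 16 * B) * S).
  apply: le_trans SE _; rewrite ler_pM2l//.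
  have := ler_wpM2l B0 Qrho; lra.
have h1 : E * 2 * s2 <= E * (2 + 16 * B) * s2.
  by rewrite ler_wpM2r// ler_pM2l//; lra.
have {}SE : S <= E * (2 + 16 * B) * s1 + E * 2 * s2 + 2^-1 * S.
  by apply: le_trans SE _; rewrite -etaE le_eqVlt; apply/orP; left; apply/eqP; ring.
lra.
Qed.

End SecondKindSystem.

(** * The Galerkin system *)

(** The two equations form one system with a square block matrix, so a trivial kernel already makes
    it invertible. *)
Lemma affine_system_unique_solution {F : fieldType} n (A11 A12 A21 A22 : 'M[F]_n) :
  (forall a b : 'rV[F]_n, a = a *m A11 + b *m A12 -> b = a *m A21 + b *m A22 ->
     a = 0 /\ b = 0) ->
  forall c1 c2 : 'rV[F]_n, exists! ab : 'rV[F]_n * 'rV[F]_n,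
    ab.1 = c1 + (ab.1 *m A11 + ab.2 *m A12) /\
    ab.2 = c2 + (ab.1 *m A21 + ab.2 *m A22).
Proof.
move=> inj c1 c2.
pose B := block_mx (1%:M - A11) (- A21) (- A12) (1%:M - A22).
have BE a b : row_mx a b *m B =
    row_mx (a - (a *m A11 + b *m A12)) (b - (a *m A21 + b *m A22)).
  rewrite mul_row_block !mulmxBr !mulmxN !mulmx1; congr row_mx.
    by rewrite opprD addrA.
  by rewrite addrCA opprD.
have uB : B \in unitmx.
  rewrite -row_free_unit; apply: inj_row_free => v.
  rewrite -[v]hsubmxK BE -row_mx0 => /eq_row_mx[/eqP + /eqP].
  rewrite !subr_eq0 => /eqP h1 /eqP h2.
  by have [-> ->] := inj _ _ h1 h2.
have eqv a b : (a = c1 + (a *m A11 + b *m A12) /\ b = c2 + (a *m A21 + b *m A22)) <->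
    row_mx a b *m B = row_mx c1 c2.
  rewrite BE; split=> [[h1 h2]|/eq_row_mx[<- <-]]; last by rewrite !subrK.
  by congr row_mx; apply/eqP; rewrite subr_eq; apply/eqP.
pose s := row_mx c1 c2 *m invmx B.
exists (lsubmx s, rsubmx s); split.
  by apply/eqv; rewrite hsubmxK mulmxKV.
move=> [a b] /eqv /= abE.
have -> : s = row_mx a b by rewrite /s -abE mulmxK.
by rewrite row_mxKl row_mxKr.
Qed.

Lemma affine_system_coord {F : fieldType} n (v a b : 'rV[F]_n) (c : 'I_n -> F)
    (A B : 'I_n -> 'I_n -> F) :
  (forall j, v 0 j = c j + (\sum_i a 0 i * A i j + \sum_i b 0 i * B i j)) <->
  v = \row_j c j + (a *m \matrix_(i, j) A i j + b *m \matrix_(i, j) B i j).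
Proof.
have E j : (\row_j c j + (a *m \matrix_(i, j) A i j + b *m \matrix_(i, j) B i j)) 0 j =
    c j + (\sum_i a 0 i * A i j + \sum_i b 0 i * B i j).
  by rewrite !mxE; congr (_ + (_ + _)); apply: eq_bigr => i _; rewrite mxE.
by split=> [vE|-> //]; apply/rowP => j; rewrite E vE.
Qed.

Section Galerkin.
Context {R : realType} (T : R) (T_gt0 : 0 < T).
Context (k11 k12 k21 k22 : R -> R -> R) (m g1 g2 : R -> R).
Context (ck11 : continuous_on_triangle T k11) (ck12 : continuous_on_triangle T k12).
Context (ck21 : continuous_on_triangle T k21) (ck22 : continuous_on_triangle T k22).
Context (cm : cont 0 T m).
Implicit Types (x y r g : R -> R) (n : nat).

Local Notation cT f := (cont 0 T f).
Local Notation sqn := (sqn T).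
Local Notation dot := (dot T).
Local Notation rcomb a := (comb T (a 0)).
Local Notation proj := (proj T).
Local Notation defect := (defect T).
Local Notation V := (shifted_legendre T).
Local Notation op1 := (volterra_pair k11 k12).
Local Notation op2 := (volterra_pair k21 k22).

(** The source [g] is a parameter so that the homogeneous system is the instance [g = 0]. *)
Definition galerkin_first n (g : R -> R) (a b : 'rV[R]_n) : Prop :=
  forall j : 'I_n, a 0 j = dot g (V j)
    + (\sum_(i < n) a 0 i * dot (volterra k11 (V i)) (V j)
       + \sum_(i < n) b 0 i * dot (volterra k12 (V i)) (V j)).

Definition galerkin_second n (g : R -> R) (a b : 'rV[R]_n) : Prop :=
  forall j : 'I_n, b 0 j = dot g (V j)
    + (\sum_(i < n) a 0 i * (dot (fun t => m t * V i t) (V j)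
                             + dot (volterra k21 (V i)) (V j))
       + \sum_(i < n) b 0 i * dot (volterra k22 (V i)) (V j)).

Lemma volterra_comb k n (a : 'I_n -> R) : continuous_on_triangle T k ->
  {in `[0, T], volterra k (comb T a) =1
     fun t => \sum_(i < n) a i * volterra k (V i) t}.
Proof.
move=> ck t tT; have cV i := cont_volterra_integrand ck (@cont_V _ _ T_gt0 i) tT.
rewrite /volterra.
under [RHS]eq_bigr do rewrite -integralZc//.
rewrite -integral_sumc => [|i]; last exact: contZ.
apply: eq_integral_cc => s _; rewrite mulr_sumr.
by apply: eq_bigr => i _; rewrite mulrCA.
Qed.

Lemma dot_volterra_comb k n (a : 'I_n -> R) j : continuous_on_triangle T k ->
  dot (volterra k (comb T a)) (V j) =
  \sum_(i < n) a i * dot (volterra k (V i)) (V j).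
Proof.
move=> ck; have cVi i := cont_volterra T_gt0 ck (@cont_V _ _ T_gt0 i).
rewrite (eq_dot _ (volterra_comb a ck)).
have cV i : cT (V i) by exact: cont_V.
rewrite dot_suml => // [|i]; last exact: contZ.
by apply: eq_bigr => i _; rewrite dotZl.
Qed.

Lemma dot_mul_comb n (a : 'I_n -> R) j :
  dot (fun t => m t * comb T a t) (V j) =
  \sum_(i < n) a i * dot (fun t => m t * V i t) (V j).
Proof.
have cV i : cT (V i) by exact: cont_V.
have cmV i : cT (fun t => m t * V i t) by exact: contM.
under [RHS]eq_bigr do rewrite -dotZl//.
rewrite -dot_suml => // [|i]; last exact: contZ.
apply: eq_dot => t _; rewrite mulr_sumr.
by apply: eq_bigr => i _; rewrite mulrCA.
Qed.

(** The [j]-th equation equates [a 0 j] with the inner product of the right-hand side and [V j],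
    which is the [j]-th coefficient of its projection. *)
Lemma galerkin_firstE n g (a b : 'rV[R]_n) : cT g -> galerkin_first g a b ->
  rcomb a = proj n (fun t => g t + op1 (rcomb a) (rcomb b) t).
Proof.
move=> cg ab; apply/funext => t; apply: eq_bigr => j _; congr (_ * _).
have cV := @cont_V _ _ T_gt0 j.
have c1 := cont_volterra T_gt0 ck11 (@cont_comb _ _ T_gt0 _ (a 0)).
have c2 := cont_volterra T_gt0 ck12 (@cont_comb _ _ T_gt0 _ (b 0)).
rewrite dotDl//; last exact: contD.
by rewrite dotDl// !dot_volterra_comb//; exact: ab.
Qed.

Lemma galerkin_secondE n g (a b : 'rV[R]_n) : cT g -> galerkin_second g a b ->
  rcomb b = proj n (fun t => g t + (m t * rcomb a t + op2 (rcomb a) (rcomb b) t)).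
Proof.
move=> cg ab; apply/funext => t; apply: eq_bigr => j _; congr (_ * _).
have cV := @cont_V _ _ T_gt0 j.
have ca := @cont_comb _ _ T_gt0 _ (a 0).
have c1 := cont_volterra T_gt0 ck21 ca.
have c2 := cont_volterra T_gt0 ck22 (@cont_comb _ _ T_gt0 _ (b 0)).
have cma : cT (fun t => m t * rcomb a t) by exact: contM.
rewrite dotDl//; last by apply: contD => //; exact: contD.
rewrite dotDl//; last exact: contD.
rewrite dotDl// dot_mul_comb !dot_volterra_comb// ab.
congr (_ + _); rewrite [RHS]addrA -[in RHS]big_split /=; congr (_ + _).
by apply: eq_bigr => i _; rewrite mulrDr.
Qed.

Lemma galerkin_unique_solution : cT g1 -> cT g2 ->
  exists N : nat, forall n, (N <= n)%N ->
    exists! ab : 'rV[R]_n * 'rV[R]_n,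
      galerkin_first g1 ab.1 ab.2 /\ galerkin_second g2 ab.1 ab.2.
Proof.
move=> cg1 cg2.
have [C C0 [N stab]] := galerkin_stability T_gt0 ck11 ck12 ck21 ck22 cm.
exists N => n Nn.
pose A11 : 'M[R]_n := \matrix_(i, j) dot (volterra k11 (V i)) (V j).
pose A12 : 'M[R]_n := \matrix_(i, j) dot (volterra k12 (V i)) (V j).
pose A21 : 'M[R]_n := \matrix_(i, j) (dot (fun t => m t * V i t) (V j)
                                      + dot (volterra k21 (V i)) (V j)).
pose A22 : 'M[R]_n := \matrix_(i, j) dot (volterra k22 (V i)) (V j).
have eq1 g (a b : 'rV[R]_n) : galerkin_first g a b <->
    a = \row_j dot g (V j) + (a *m A11 + b *m A12).
  exact: affine_system_coord.
have eq2 g (a b : 'rV[R]_n) : galerkin_second g a b <->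
    b = \row_j dot g (V j) + (a *m A21 + b *m A22).
  exact: affine_system_coord.
have c0 : cT (fun=> 0) by exact: cont_cst.
have dot0 (j : 'I_n) : dot (fun=> 0) (V j) = 0.
  rewrite -[RHS](integral0c 0 T); apply: eq_integral_cc => t _; exact: mul0r.
have inj (a b : 'rV[R]_n) : a = a *m A11 + b *m A12 -> b = a *m A21 + b *m A22 ->
    a = 0 /\ b = 0.
  have row0 : \row_(j < n) dot (fun=> 0) (V j) = 0 by apply/rowP => j; rewrite !mxE.
  move=> h1 h2; have ab1 : galerkin_first (fun=> 0) a b by apply/eq1; rewrite row0 add0r.
  have ab2 : galerkin_second (fun=> 0) a b by apply/eq2; rewrite row0 add0r.
  have := stab n (rcomb a) (rcomb b) _ _ Nn (@cont_comb _ _ T_gt0 _ _)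
    (@cont_comb _ _ T_gt0 _ _) c0 c0.
  have sqn0 : sqn (fun=> 0) = 0.
    by rewrite -[RHS](integral0c 0 T); apply: eq_integral_cc => t _; rewrite expr0n.
  rewrite sqn0 addr0 mulr0 !sqn_comb// => /(_ _ _) ab0.
  have {}ab0 : \sum_(i < n) a 0 i ^+ 2 + \sum_(i < n) b 0 i ^+ 2 <= 0.
    apply: ab0 => t tT; rewrite addr0.
      rewrite {1}(galerkin_firstE c0 ab1); congr (proj _ _ _).
      by apply/funext => s; rewrite add0r.
    rewrite {1}(galerkin_secondE c0 ab2); congr (proj _ _ _).
    by apply/funext => s; rewrite add0r.
  have sa : 0 <= \sum_(i < n) a 0 i ^+ 2 by apply: sumr_ge0 => i _; exact: sqr_ge0.
  have sb : 0 <= \sum_(i < n) b 0 i ^+ 2 by apply: sumr_ge0 => i _; exact: sqr_ge0.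
  have sum0 (v : 'rV[R]_n) : \sum_(i < n) v 0 i ^+ 2 = 0 -> v = 0.
    move=> /eqP; rewrite psumr_eq0 => [/allP v0|i _]; last exact: sqr_ge0.
    apply/rowP => i; have := v0 i (mem_index_enum i).
    by rewrite sqrf_eq0 mxE => /eqP.
  by split; apply: sum0; lra.
have [[a b] [[ab1 ab2] uab]] :=
  affine_system_unique_solution inj (\row_j dot g1 (V j)) (\row_j dot g2 (V j)).
exists (a, b); split.
  by split; [exact: (eq1 g1 a b).2 ab1|exact: (eq2 g2 a b).2 ab2].
move=> [a' b'] [h1 h2]; apply: uab.
by split; [exact: (eq1 g1 a' b').1 h1|exact: (eq2 g2 a' b').1 h2].
Qed.

Lemma volterraB k x y : continuous_on_triangle T k -> cT x -> cT y ->
  {in `[0, T], volterra k (fun t => x t - y t) =1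
     fun t => volterra k x t - volterra k y t}.
Proof.
move=> ck cx cy t tT; rewrite /volterra -integralBc; try exact: cont_volterra_integrand.
by apply: eq_integral_cc => s _; rewrite mulrBr.
Qed.

Lemma sqn_volterra_le k : continuous_on_triangle T k ->
  exists2 A : R, 0 <= A & forall e, cT e -> sqn (volterra k e) <= A * sqn e.
Proof.
move=> ck; have [A A0 AP] := volterra_sqr_le T_gt0 ck.
exists (A * T); first by rewrite mulr_ge0// ltW.
move=> e ce; rewrite (_ : A * T * _ = A * sqn e * (T - 0)); last by ring.
rewrite -(integral_cstc (A * sqn e) (ltW T_gt0)); apply: le_integralc.
- by apply: contX2; exact: cont_volterra.
- exact: cont_cst.
- move=> t tT; apply: le_trans (AP e ce t tT) _.
  rewrite ler_wpM2l//; move: tT; rewrite in_itv /= => /andP[? ?].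
  exact: integral_sqr_sub.
Qed.

(** Needed because the differentiated equation is available only in the open interval. *)
Lemma eq_proj_oo n f g : cT g -> {in `]0, T[, f =1 g} -> proj n f = proj n g.
Proof.
move=> cg fg; apply/funext => t; apply: eq_bigr => i _; congr (_ * _).
apply: eq_integral_oo; first by apply: contM => //; exact: cont_V.
by move=> s sT; rewrite fg.
Qed.

Lemma galerkin_error : cT g1 -> cT g2 ->
  exists2 C : R, 0 < C & exists N : nat,
    forall x y, cT x -> cT y ->
      {in `[0, T], forall t, x t = g1 t + op1 x y t} ->
      {in `]0, T[, forall t, y t = g2 t + (m t * x t + op2 x y t)} ->
    forall n (a b : 'rV[R]_n), (N <= n)%N ->
      galerkin_first g1 a b -> galerkin_second g2 a b ->
    sqn (fun t => x t - rcomb a t) + sqn (fun t => y t - rcomb b t) <=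
    C * (sqn (defect n x) + sqn (defect n y)).
Proof.
move=> cg1 cg2.
have [C C0 [N stab]] := galerkin_stability T_gt0 ck11 ck12 ck21 ck22 cm.
have [A11 A110 A11P] := sqn_volterra_le ck11.
have [A12 A120 A12P] := sqn_volterra_le ck12.
have [A21 A210 A21P] := sqn_volterra_le ck21.
have [A22 A220 A22P] := sqn_volterra_le ck22.
have [M M0 mM] := cont_bound (ltW T_gt0) cm.
pose B := 2 * A11 + 2 * A12 + 2 * M ^+ 2 + 4 * A21 + 4 * A22.
have B0 : 0 <= B by rewrite !addr_ge0// mulr_ge0// sqr_ge0.
(* Each error splits as [e - d], at the cost of a factor 2; stability gives [C] times the residuals,
   and these are at most [B] times the squared norm of [(e1, e2)]. *)
exists (2 + 2 * C * B); first by rewrite ltr_wpDr// !mulr_ge0// ltW.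
exists N => x y cx cy xE yE n a b Nn aE bE.
have ca : cT (rcomb a) by exact: cont_comb.
have cb : cT (rcomb b) by exact: cont_comb.
(* [(d1, d2)] is the part of the error inside X_n, called [e] in the overview; [e1] and [e2] are the
   projection errors of the solution. *)
pose d1 t := rcomb a t - proj n x t; pose d2 t := rcomb b t - proj n y t.
pose e1 := defect n x; pose e2 := defect n y.
have cd1 : cT d1 by apply: contB => //; exact: cont_proj.
have cd2 : cT d2 by apply: contB => //; exact: cont_proj.
have ce1 : cT e1 by exact: cont_defect.
have ce2 : cT e2 by exact: cont_defect.
have volE k (f g d e : R -> R) : continuous_on_triangle T k -> cT f -> cT g ->
    cT d -> cT e -> (forall t, f t - g t = d t - e t) ->
    {in `[0, T], forall t, volterra k f t - volterra k g t =
      volterra k d t - volterra k e t}.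
  move=> ck cf cg cd ce fgE t tT; rewrite -!volterraB//.
  by congr (volterra k _ t); apply/funext => s.
have aE1 t : rcomb a t - x t = d1 t - e1 t by rewrite /d1 /e1 /defect; ring.
have bE1 t : rcomb b t - y t = d2 t - e2 t by rewrite /d2 /e2 /defect; ring.
have cop1 f g : cT f -> cT g -> cT (op1 f g) by exact: cont_volterra_pair.
have cop2 f g : cT f -> cT g -> cT (op2 f g) by exact: cont_volterra_pair.
have cm' f : cT f -> cT (fun t => m t * f t) by exact: contM.
pose r1 := op1 e1 e2; pose r2 t := m t * e1 t + op2 e1 e2 t.
have cr1 : cT r1 by exact: cop1.
have cr2 : cT r2 by apply: contD; [exact: cm'|exact: cop2].
have h1 : {in `[0, T], forall t, d1 t = proj n (op1 d1 d2) t + (-1) * proj n r1 t}.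
  have dE : d1 = proj n (fun t => op1 d1 d2 t - r1 t).
    transitivity (fun t => rcomb a t - proj n x t) => //.
    rewrite (galerkin_firstE cg1 aE) (eq_proj n xE) -projB//;
      try by apply: contD => //; exact: cop1.
    apply: eq_proj => t tT.
    have := volE _ _ _ _ _ ck11 ca cx cd1 ce1 aE1 t tT.
    have := volE _ _ _ _ _ ck12 cb cy cd2 ce2 bE1 t tT.
    rewrite /r1 /volterra_pair => v2 v1; rewrite opprD addrACA subrr add0r opprD addrACA v1 v2.
    by rewrite addrACA -opprD.
  have pE := projB T_gt0 n (cop1 _ _ cd1 cd2) cr1.
  by move=> t _; rewrite mulN1r; exact: (congr1 (@^~ t) (etrans dE pE)).
have h2 : {in `[0, T], forall t, d2 t =
    proj n (fun s => m s * d1 s + op2 d1 d2 s) t + (-1) * proj n r2 t}.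
  have c1 : cT (fun t => m t * d1 t + op2 d1 d2 t) by apply: contD; [exact: cm'|exact: cop2].
  have dE : d2 = proj n (fun t => m t * d1 t + op2 d1 d2 t - r2 t).
    have cab : cT (fun t => g2 t + (m t * rcomb a t + op2 (rcomb a) (rcomb b) t)).
      by apply: contD => //; apply: contD; [exact: cm'|exact: cop2].
    have cxy : cT (fun t => g2 t + (m t * x t + op2 x y t)).
      by apply: contD => //; apply: contD; [exact: cm'|exact: cop2].
    transitivity (fun t => rcomb b t - proj n y t) => //.
    rewrite (galerkin_secondE cg2 bE) (eq_proj_oo n cxy yE) -projB//.
    apply: eq_proj => t tT.
    have := volE _ _ _ _ _ ck21 ca cx cd1 ce1 aE1 t tT.
    have := volE _ _ _ _ _ ck22 cb cy cd2 ce2 bE1 t tT.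
    have aux1 (g p q A A' D D' : R) : g + (p + (A + D)) - (g + (q + (A' + D'))) =
        p - q + (A - A' + (D - D')) by ring.
    have aux2 (p q A A' D D' : R) :
        p - q + (A - A' + (D - D')) = p + (A + D) - (q + (A' + D')) by ring.
    rewrite /r2 /volterra_pair => v2 v1; rewrite aux1 -mulrBr aE1 v1 v2 mulrBr.
    exact: aux2.
  have pE := projB T_gt0 n c1 cr2.
  by move=> t _; rewrite mulN1r; exact: (congr1 (@^~ t) (etrans dE pE)).
have pr1 : cT (fun t => -1 * proj n r1 t) by apply: contZ; exact: cont_proj.
have pr2 : cT (fun t => -1 * proj n r2 t) by apply: contZ; exact: cont_proj.
have {h1 h2} stab1 := stab n d1 d2 _ _ Nn cd1 cd2 pr1 pr2 h1 h2.
have q1 : sqn (fun t => -1 * proj n r1 t) <= 2 * (A11 * sqn e1) + 2 * (A12 * sqn e2).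
  rewrite sqnZ ?sqrrN ?expr1n ?mul1r; last exact: cont_proj.
  apply: le_trans (sqn_proj_le _ _ cr1) _ => //.
  apply: le_trans (sqnD _ _) _; try exact: cont_volterra.
  by rewrite lerD// ler_pM2l//; [exact: A11P|exact: A12P].
have q2 : sqn (fun t => -1 * proj n r2 t) <= 2 * (M ^+ 2 * sqn e1) +
    2 * (2 * (A21 * sqn e1) + 2 * (A22 * sqn e2)).
  rewrite sqnZ ?sqrrN ?expr1n ?mul1r; last exact: cont_proj.
  apply: le_trans (sqn_proj_le _ _ cr2) _ => //.
  apply: le_trans (sqnD (cm' _ ce1) (cop2 _ _ ce1 ce2)) _.
  rewrite lerD// ler_pM2l//.
    rewrite -integralZc; last exact: contX2.
    apply: le_integralc; [by apply/contX2/cm'|by apply: contZ; exact: contX2|].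
    move=> t tT; rewrite exprMn ler_wpM2r ?sqr_ge0//.
    by rewrite -[leLHS]real_normK ?num_real// lerXn2r ?nnegrE ?mM// ltW.
  apply: le_trans (sqnD _ _) _; try exact: cont_volterra.
  by rewrite lerD// ler_pM2l//; [exact: A21P|exact: A22P].
have split_error z c d e : cT d -> cT e -> (forall t, z t - c t = e t + -1 * d t) ->
    sqn (fun t => z t - c t) <= 2 * sqn e + 2 * sqn d.
  move=> cd ce zE.
  have -> : (fun t => z t - c t) = fun t => e t + -1 * d t by exact/funext.
  have cNd : cT (fun t => -1 * d t) by exact: contZ.
  apply: le_trans (sqnD ce cNd) _.
  by rewrite sqnZ// sqrrN expr1n mul1r.
have p1 : sqn (fun t => x t - rcomb a t) <= 2 * sqn e1 + 2 * sqn d1.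
  by apply: split_error => // t; rewrite /e1 /d1 /defect; ring.
have p2 : sqn (fun t => y t - rcomb b t) <= 2 * sqn e2 + 2 * sqn d2.
  by apply: split_error => // t; rewrite /e2 /d2 /defect; ring.
have final (X1 X2 E1 E2 D1 D2 Q1 Q2 : R) : 0 <= E1 -> 0 <= E2 ->
    X1 <= 2 * E1 + 2 * D1 -> X2 <= 2 * E2 + 2 * D2 -> D1 + D2 <= C * (Q1 + Q2) ->
    Q1 <= 2 * (A11 * E1) + 2 * (A12 * E2) ->
    Q2 <= 2 * (M ^+ 2 * E1) + 2 * (2 * (A21 * E1) + 2 * (A22 * E2)) ->
    X1 + X2 <= (2 + 2 * C * B) * (E1 + E2).
  clear -C0 A110 A120 A210 A220 => E10 E20 X1E X2E DE Q1E Q2E.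
  have QB : Q1 + Q2 <= B * (E1 + E2).
    have a1 := mulr_ge0 A110 E20; have a2 := mulr_ge0 A120 E10.
    have a3 := mulr_ge0 A210 E20; have a4 := mulr_ge0 A220 E10.
    have a5 := mulr_ge0 (sqr_ge0 M) E20.
    by rewrite /B; lra.
  have := ler_wpM2l (ltW C0) QB; lra.
exact: final (sqn_ge0 T e1) (sqn_ge0 T e2) p1 p2 stab1 q1 q2.
Qed.

End Galerkin.

(** * Differentiation of a Volterra integral *)

Section Leibniz.
Context {R : realType} (T : R) (T_gt0 : 0 < T).
Let T_ge0 : 0 <= T := ltW T_gt0.

(** Telescoping over a uniform grid of step below [d]. It stands in for a zero derivative and needs
    no differentiability, in particular none at the end points. *)
Lemma eq_of_small_increments (F : R -> R) :
  (forall e : R, 0 < e -> exists2 d : R, 0 < d & {in `[0, T] &, forall t t',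
     t <= t' -> t' - t < d -> `|F t' - F t| <= e * (t' - t)}) ->
  {in `[0, T], forall t, F t = F 0}.
Proof.
move=> small t tT; apply/eqP; rewrite -subr_eq0 -normr_le0.
have := tT; rewrite in_itv /= => /andP[t0 tT'].
apply/ler_addgt0Pl => e e0; rewrite addr0.
have [d d0 dP] := small (e / (T + 1)) (divr_gt0 e0 (ltr_wpDl T_ge0 ltr01)).
pose n := Num.bound (t / d).
have td0 : 0 <= t / d by rewrite divr_ge0// ltW.
have n0 : 0 < n%:R :> R := le_lt_trans td0 (archi_boundP td0).
have step : t / n%:R < d.
  by rewrite ltr_pdivrMr// mulrC -ltr_pdivrMr// archi_boundP.
have tn0 : 0 <= t / n%:R by rewrite divr_ge0// ltW.
have grid i : (i <= n)%N -> `|F (t / n%:R * i%:R) - F 0| <= e / (T + 1) * (t / n%:R * i%:R).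
  have inT k : (k <= n)%N -> t / n%:R * k%:R \in `[0, T].
    move=> kn; rewrite in_itv /= mulr_ge0//=; apply: le_trans tT'.
    by rewrite mulrAC ler_pdivrMr// ler_wpM2l// ler_nat.
  elim: i => [|i IH] ni; first by rewrite mulr0 subrr normr0 mulr0.
  have hE : t / n%:R * i.+1%:R - t / n%:R * i%:R = t / n%:R by rewrite -natr1; ring.
  have le_i : t / n%:R * i%:R <= t / n%:R * i.+1%:R by rewrite ler_wpM2l// ler_nat.
  have := dP _ _ (inT _ (ltnW ni)) (inT _ ni) le_i; rewrite hE => /(_ step) h.
  rewrite -(subrKA (F (t / n%:R * i%:R))).
  apply: le_trans (ler_normD _ _) (le_trans (lerD h (IH (ltnW ni))) _).
  by rewrite -mulrDr -[t / n%:R * i.+1%:R](subrK (t / n%:R * i%:R)) hE.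
have := grid n (leqnn n); rewrite divfK ?gt_eqF// => /le_trans; apply.
rewrite mulrAC ler_pdivrMr ?ltr_wpDl// ler_wpM2l ?(ltW e0)//.
by rewrite (le_trans tT')// lerDl.
Qed.

(** The increments of the difference of both sides are shown to be small. Over [[0, t]] the mean
    value theorem and the uniform continuity of [kt] apply; over [[t, t']] the uniform continuity of
    [k] near the diagonal and of [volterra kt x]. *)
Lemma volterra_leibniz (k kt : R -> R -> R) (x : R -> R) :
  continuous_on_triangle T k -> continuous_on_triangle T kt -> cont 0 T x ->
  (forall t s, 0 < s < t -> t < T -> is_derive t 1 (k^~ s) (kt t s)) ->
  {in `[0, T], forall t, volterra k x t =
    integral 0 t (fun s => k s s * x s + volterra kt x s)}.
Proof.
move=> ck ckt cx dk.
have ckd := kernel_diag ck.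
pose D s := k s s * x s + volterra kt x s.
have cW : cont 0 T (volterra kt x) by exact: cont_volterra.
have cD : cont 0 T D by apply: contD => //; exact: contM.
pose F t := volterra k x t - integral 0 t D.
have F0 : F 0 = 0.
  by rewrite /F /volterra set_itv1 !Rintegral_set1 subrr.
suff FE : {in `[0, T], forall t, F t = F 0}.
  by move=> t /FE; rewrite F0 => /eqP; rewrite subr_eq0 => /eqP.
apply: eq_of_small_increments => e e0.
have [X X0 xX] := cont_bound T_ge0 cx.
(* The bound [e1] contributes [X * T] to the denominator and the bound [e2] contributes [X + 1]. *)
pose eta := e / (X * T + X + 1).
have den0 : 0 < X * T + X + 1 by rewrite !addr_gt0// mulr_gt0.
have eta0 : 0 < eta by exact: divr_gt0.
have [d1 d10 kd] := kernel_unif T_ge0 ck eta0.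
have [d2 d20 ktd] := kernel_unif T_ge0 ckt eta0.
have [d3 d30 Wd] := heine_cantor (@segment_compact R 0 T) cW eta0.
exists (Num.min d1 (Num.min d2 d3)); first by rewrite !lt_min d10 d20.
move=> t t' tT t'T tt'; rewrite !lt_min => /and3P[h1 h2 h3].
have := tT; have := t'T; rewrite !in_itv /= => /andP[t'0 t'T'] /andP[t0 tT'].
pose h := t' - t; have h0 : 0 <= h by rewrite subr_ge0.
have ikt := cont_volterra_integrand ck cx tT.
have ikt' := cont_volterra_integrand ck cx t'T.
have iktt := cont_volterra_integrand ckt cx tT.
have ik0t : cont 0 t (fun s => k t' s * x s) by exact: cont_sub ikt'.
have iktt' : cont t t' (fun s => k t' s * x s) by exact: cont_sub ikt'.
have cDtt' : cont t t' D by exact: cont_sub cD.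
have cDt' : cont 0 t' D by exact: cont_sub cD.
have FE : F t' - F t =
    integral 0 t (fun s => k t' s * x s - k t s * x s - h * (kt t s * x s)) +
    integral t t' (fun s => k t' s * x s - D s + volterra kt x t).
  rewrite integralBc; [|exact: contB|exact: contZ].
  rewrite integralBc// integralZc//.
  rewrite integralDc; [|exact: contB|exact: cont_cst].
  rewrite integralBc// integral_cstc//.
  rewrite /F /volterra (@integral_split _ 0 t t') ?t0//.
  rewrite (@integral_split _ 0 t t' D) ?t0// /h; ring.
have e1 : `|integral 0 t (fun s => k t' s * x s - k t s * x s - h * (kt t s * x s))|
    <= eta * h * X * (t - 0).
  apply: integral_norm_le_oo => //.
    by apply: contB; [exact: contB|exact: contZ].
  move=> s; rewrite in_itv /= => /andP[s0 st].
  have [tt|tt] := eqVneq t t'.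
    have -> : h = 0 by rewrite /h tt subrr.
    by rewrite -tt subrr mul0r subrr normr0 mulr0 mul0r.
  have {}tt : t < t' by rewrite lt_neqAle tt.
  have ckcol : cont t t' (k^~ s) by apply: cont_sub (kernel_col (ltW s0) ck) => //; exact: ltW.
  have [|z + zE] := @MVT _ (k^~ s) (kt^~ s) t t' tt _ ckcol.
    move=> z; rewrite in_itv /= => /andP[tz zt'].
    by apply: dk; rewrite ?s0 ?(lt_trans st)// (lt_le_trans zt').
  rewrite in_itv /= => /andP[tz zt'].
  have -> : k t' s * x s - k t s * x s - h * (kt t s * x s) =
      (kt z s - kt t s) * h * x s.
    by rewrite -mulrBl zE /h; ring.
  rewrite !normrM (ger0_norm h0) ler_pM ?mulr_ge0//; last first.
    by apply: xX; rewrite in_itv /= (ltW s0) (le_trans (ltW st)).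
  rewrite ler_wpM2r// ltW// ktd//.
  - by rewrite /triangle /= (ltW s0) (ltW (lt_trans st tz)) (le_trans (ltW zt')).
  - by rewrite /triangle /= (ltW s0) (ltW st).
  - rewrite gtr0_norm ?subr_gt0//; apply: le_lt_trans h2.
    by rewrite lerD2r ltW.
  - by rewrite subrr normr0.
have e2 : `|integral t t' (fun s => k t' s * x s - D s + volterra kt x t)|
    <= (eta * X + eta) * (t' - t).
  apply: integral_norm_le_oo => //.
    by apply: contD; [exact: contB|exact: cont_cst].
  move=> s; rewrite in_itv /= => /andP[ts st'].
  have sT : s \in `[0, T].
    by rewrite in_itv /= (le_trans t0 (ltW ts)) (le_trans (ltW st')).
  have -> : k t' s * x s - D s + volterra kt x t =
      (k t' s - k s s) * x s + (volterra kt x t - volterra kt x s).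
    by rewrite /D; ring.
  apply: le_trans (ler_normD _ _) _; apply: lerD.
    rewrite normrM ler_pM//; last exact: xX.
    have := sT; rewrite in_itv /= => /andP[s0 sT'].
    rewrite ltW// kd//.
    + by rewrite /triangle /= s0 (ltW st').
    + by rewrite /triangle /= s0 lexx.
    + rewrite gtr0_norm ?subr_gt0//; apply: le_lt_trans h1.
      by rewrite lerD2l lerN2 ltW.
    + by rewrite subrr normr0.
  apply/ltW/Wd => //; rewrite /ball /= distrC gtr0_norm ?subr_gt0//.
  by apply: le_lt_trans h3; rewrite lerD2r ltW.
rewrite FE; apply: le_trans (ler_normD _ _) _.
apply: le_trans (lerD e1 e2) _; rewrite -/h subr0.
have etaE : e = eta * (X * T + X + 1) by rewrite /eta divfK// gt_eqF.
have le_tT : eta * h * X * t <= eta * h * X * T.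
  by apply: ler_wpM2l => //; apply: mulr_ge0 (ltW X0); apply: mulr_ge0 h0; exact: ltW.
have -> : e * h = eta * h * X * T + (eta * X + eta) * h by rewrite etaE; ring.
by rewrite lerD2r.
Qed.

End Leibniz.

(** * From the integral-algebraic system to second-kind equations *)

Section Reduction.
Context {R : realType} (T : R) (T_gt0 : 0 < T).
Implicit Types (k kt : R -> R -> R) (f : R -> R).
Local Notation V := (shifted_legendre T).
Local Notation dot := (dot T).
Local Notation sqn := (sqn T).
Let T_ge0 : 0 <= T := ltW T_gt0.

Lemma C1_triangle_dt k : C1_triangle T k ->
  exists kt, [/\ continuous_on_triangle T kt,
    (forall t s, 0 < s < t -> t < T -> is_derive t 1 (k^~ s) (kt t s))
    & (forall t s, 0 < s < t -> t < T -> dt k t s = kt t s)].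
Proof.
move=> [_ dk [kt [ks [ckt _ ktE]]]]; exists kt; split => //.
  move=> t s st tT; have [dkt _] := dk t s st tT.
  by have [<- _] := ktE t s st tT; split => //; rewrite /dt derive1E.
by move=> t s st tT; have [-> _] := ktE t s st tT.
Qed.

Lemma dot_volterra_int k f g : continuous_on_triangle T k -> cont 0 T f ->
  dot (volterra k f) g =
  integral 0 T (fun t => integral 0 t (fun s => k t s * f s * g t)).
Proof.
move=> ck cf; apply: eq_integral_cc => t tT; rewrite /volterra mulrC.
rewrite -integralZc; last exact: cont_volterra_integrand.
by apply: eq_integral_cc => s _; rewrite mulrC.
Qed.

(** [dt k] is known only for [0 < s < t < T], so the exchange with [kt] discards end points in both
    the outer and the inner integral. *)
Lemma dot_volterra_dt (c : R -> R) k kt f g :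
  cont 0 T c -> continuous_on_triangle T kt -> cont 0 T f -> cont 0 T g ->
  (forall t s, 0 < s < t -> t < T -> dt k t s = kt t s) ->
  dot (volterra (fun t s => - c t * kt t s) f) g =
  - integral 0 T (fun t => integral 0 t (fun s => c t * dt k t s * f s * g t)).
Proof.
move=> cc ckt cf cg ktE.
have ck : continuous_on_triangle T (fun t s => - c t * kt t s).
  by apply: kernelM => //; exact: contN.
have cv : cont 0 T (volterra (fun t s => - c t * kt t s) f) by exact: cont_volterra.
have ch : cont 0 T (fun t => - (volterra (fun t s => - c t * kt t s) f t * g t)).
  by apply: contN; exact: contM.
rewrite (eq_integral_oo ch).
  by rewrite integralNc ?opprK//; exact: contM.
move=> t /[dup] tT; rewrite in_itv /= => /andP[t0 tT'].
have tT0 : t \in `[0, T] by exact: subset_itv_oo_cc.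
have ci := cont_volterra_integrand ck cf tT0.
rewrite -mulNr mulrC -integralNc// -integralZc; last exact: contN.
apply: eq_integral_oo; first by apply: contZ; exact: contN.
by move=> s; rewrite in_itv /= => st; rewrite ktE//; ring.
Qed.

Lemma L2normE (u v : (R -> R) * (R -> R)) : L2norm T (u - v) =
  Num.sqrt (sqn (fun t => u.1 t - v.1 t) + sqn (fun t => u.2 t - v.2 t)).
Proof. by []. Qed.

Lemma expansionE n (a b : 'rV[R]_n) :
  expansion T a b = (comb T (a 0), comb T (b 0)).
Proof. by []. Qed.

(** Pythagoras in the product space: orthogonality makes only the sum of the two cross terms [J]
    vanish, so the components cannot be treated separately. *)
Lemma orthogonal_projection_best n u p (a b : 'rV[R]_n) :
  cont 0 T u.1 -> cont 0 T u.2 -> orthogonal_projection T n u p ->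
  L2norm T (u - p) <= L2norm T (u - expansion T a b).
Proof.
move=> cu1 cu2 [[c [d ->]] orth].
rewrite !L2normE ler_wsqrtr// !expansionE /=.
pose J (x : R -> R) (v w : 'rV[R]_n) :=
  integral 0 T (fun t => (x t - comb T (v 0) t) * comb T ((v - w) 0) t).
have J0 : J u.1 c a + J u.2 d b = 0.
  exact: orth (expansion T (c - a) (d - b))
    (ex_intro _ (c - a) (ex_intro _ (d - b) erefl)).
have cc (w : 'rV[R]_n) : cont 0 T (comb T (w 0)) by exact: cont_comb.
have key (x : R -> R) (v w : 'rV[R]_n) : cont 0 T x ->
    sqn (fun t => x t - comb T (w 0) t) = sqn (fun t => x t - comb T (v 0) t) +
      2 * J x v w +
      sqn (comb T ((v - w) 0)).
  move=> cx; have c1 : cont 0 T (fun t => x t - comb T (v 0) t) by exact: contB.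
  rewrite -integralZc; last exact: contM.
  rewrite -integralDc; [|exact: contX2|by apply: contZ; exact: contM].
  rewrite -integralDc; [|apply: contD; [exact: contX2|]|exact: contX2]; last first.
    by apply: contZ; exact: contM.
  apply: eq_integral_cc => t _.
  have -> : comb T ((v - w) 0) t = comb T (v 0) t - comb T (w 0) t.
    by rewrite /comb -sumrB; apply: eq_bigr => i _; rewrite !mxE mulrBl.
  by ring.
rewrite (key u.1 c a)// (key u.2 d b)//.
have aux (x1 x2 j1 j2 s1 s2 : R) : j1 + j2 = 0 -> 0 <= s1 -> 0 <= s2 ->
  x1 + x2 <= x1 + 2 * j1 + s1 + (x2 + 2 * j2 + s2) by lra.
by apply: aux => //; exact: sqn_ge0.
Qed.

Section DifferentiatedEquation.
Context (f1 f2 df : R -> R) (k11 k12 k21 k22 kt21 kt22 : R -> R -> R).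
Context (cdf : cont 0 T df) (dfE : {in `]0, T[, forall t, derive1 f2 t = df t}).
Context (ck11 : continuous_on_triangle T k11) (ck12 : continuous_on_triangle T k12).
Context (ck21 : continuous_on_triangle T k21) (ck22 : continuous_on_triangle T k22).
Context (ckt21 : continuous_on_triangle T kt21) (ckt22 : continuous_on_triangle T kt22).
Context (k22_neq0 : {in `[0, T], forall t, k22 t t != 0}).

(** These are the coefficients of the differentiated equation solved for [y], with [df], [kt21] and
    [kt22] in place of the derivatives. *)
Let c t := (k22 t t)^-1.
Let m t := - c t * k21 t t.
Let g2 t := - c t * df t.
Let l21 t s := - c t * kt21 t s.
Let l22 t s := - c t * kt22 t s.

Let cc : cont 0 T c.
Proof. by apply: contV => //; exact: kernel_diag. Qed.

Let cNc : cont 0 T (fun t => - c t).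
Proof. exact: contN. Qed.

(** By the integrated Leibniz rule and [f2 0 = 0], the second equation says that [df + D1 + D2] has
    zero integral over every [[0, t]]; hence it vanishes inside, and [k22 t t] can be divided
    out. *)
Lemma differentiated_equation x y : cont 0 T f2 -> f2 0 = 0 ->
  {in `]0, T[, forall t, derivable f2 t 1} ->
  (forall t s, 0 < s < t -> t < T -> is_derive t 1 (k21^~ s) (kt21 t s)) ->
  (forall t s, 0 < s < t -> t < T -> is_derive t 1 (k22^~ s) (kt22 t s)) ->
  cont 0 T x -> cont 0 T y ->
  {in `[0, T], forall t,
    0 = f2 t + integral 0 t (fun s => k21 t s * x s + k22 t s * y s)} ->
  {in `]0, T[, forall t, y t = g2 t + (m t * x t + volterra_pair l21 l22 x y t)}.
Proof.
move=> cf2 f20 df2 dk21 dk22 cx cy eq2.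
pose D1 t := k21 t t * x t + volterra kt21 x t.
pose D2 t := k22 t t * y t + volterra kt22 y t.
have cD1 : cont 0 T D1.
  by apply: contD; [apply: contM => //; exact: kernel_diag|exact: cont_volterra].
have cD2 : cont 0 T D2.
  by apply: contD; [apply: contM => //; exact: kernel_diag|exact: cont_volterra].
have cD : cont 0 T (fun t => df t + (D1 t + D2 t)) by apply: contD => //; exact: contD.
have I0 : {in `[0, T], forall t, integral 0 t (fun t => df t + (D1 t + D2 t)) = 0}.
  move=> t tT; have := tT; rewrite in_itv /= => /andP[t0 tT'].
  have sub f : cont 0 T f -> cont 0 t f by exact: cont_sub.
  rewrite integralDc; [|exact: sub|by apply: sub; exact: contD].
  rewrite integralDc; [|exact: sub|exact: sub].
  rewrite -(volterra_leibniz T_gt0 ck21 ckt21 cx dk21 tT).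
  rewrite -(volterra_leibniz T_gt0 ck22 ckt22 cy dk22 tT).
  rewrite (integral_ftc2 t0 (sub _ cdf) (sub _ cf2)) => [|s]; last first.
    rewrite in_itv /= => /andP[s0 st].
    have sT : s \in `]0, T[ by rewrite in_itv /= s0 (lt_le_trans st).
    by split; [exact: df2|rewrite -derive1E dfE].
  rewrite f20 subr0 [RHS](eq2 t tT) integralDc//; exact: cont_volterra_integrand.
move=> t tT; have tT0 : t \in `[0, T] by exact: subset_itv_oo_cc.
have D0 := integral_eq0_cont T_ge0 cD I0 tT.
have lE k f : continuous_on_triangle T k -> cont 0 T f ->
    volterra (fun t s => - c t * k t s) f t = - c t * volterra k f t.
  move=> ck cf; rewrite -integralZc; last exact: cont_volterra_integrand.
  by apply: eq_integral_cc => s _; rewrite mulrA.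
rewrite /volterra_pair /l21 /l22 !lE// /g2 /m /c.
have k0 := k22_neq0 tT0.
have -> : df t = - (D1 t + D2 t) by apply/eqP; rewrite -addr_eq0; apply/eqP.
by rewrite /D1 /D2; field.
Qed.

Lemma galerkin_systemE n (a b : 'rV[R]_n) :
  (forall t s, 0 < s < t -> t < T -> dt k21 t s = kt21 t s) ->
  (forall t s, 0 < s < t -> t < T -> dt k22 t s = kt22 t s) ->
  galerkin_system T f1 f2 k11 k12 k21 k22 a b <->
  galerkin_first T k11 k12 f1 a b /\ galerkin_second T l21 l22 m g2 a b.
Proof.
move=> kt21E kt22E.
have cV i : cont 0 T (V i) by exact: cont_V.
have g2E j : dot g2 (V j) =
    - integral 0 T (fun t => derive1 f2 t / k22 t t * V j t).
  have cg : cont 0 T (fun t => c t * df t * V j t) by do 2 apply: contM => //.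
  rewrite (eq_integral_oo cg) => [|t tT]; last by rewrite dfE// /c (mulrC (df t)).
  by rewrite -integralNc//; apply: eq_integral_cc => t _; rewrite /g2 !mulNr.
have mE i j : dot (fun t => m t * V i t) (V j) =
    - integral 0 T (fun t => k21 t t / k22 t t * V i t * V j t).
  have cg : cont 0 T (fun t => k21 t t / k22 t t * V i t * V j t).
    do 2 apply: contM => //; apply: contM => //; exact: kernel_diag.
  rewrite -integralNc//; apply: eq_integral_cc => t _.
  by rewrite /m /c mulNr (mulrC (k21 t t)) !mulNr.
have l21E i j := dot_volterra_dt cc ckt21 (cV i) (cV j) kt21E.
have l22E i j := dot_volterra_dt cc ckt22 (cV i) (cV j) kt22E.
have k11E i j := dot_volterra_int (V j) ck11 (cV i).
have k12E i j := dot_volterra_int (V j) ck12 (cV i).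
have firstE (j : 'I_n) : dot f1 (V j)
    + (\sum_(i < n) a 0 i * dot (volterra k11 (V i)) (V j)
       + \sum_(i < n) b 0 i * dot (volterra k12 (V i)) (V j)) =
    integral 0 T (fun t => f1 t * V j t)
    + \sum_(i < n) a 0 i * integral 0 T (fun t => integral 0 t (fun s =>
        k11 t s * V i s * V j t))
    + \sum_(i < n) b 0 i * integral 0 T (fun t => integral 0 t (fun s =>
        k12 t s * V i s * V j t)).
  rewrite -addrA; congr (_ + (_ + _)); apply: eq_bigr => i _.
    by rewrite k11E.
  by rewrite k12E.
have secondE (j : 'I_n) : dot g2 (V j)
    + (\sum_(i < n) a 0 i * (dot (fun t => m t * V i t) (V j)
                             + dot (volterra l21 (V i)) (V j))
       + \sum_(i < n) b 0 i * dot (volterra l22 (V i)) (V j)) =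
    - integral 0 T (fun t => derive1 f2 t / k22 t t * V j t)
    - \sum_(i < n) a 0 i * integral 0 T (fun t => integral 0 t (fun s =>
        (k22 t t)^-1 * dt k21 t s * V i s * V j t))
    - \sum_(i < n) a 0 i * integral 0 T (fun t =>
        k21 t t / k22 t t * V i t * V j t)
    - \sum_(i < n) b 0 i * integral 0 T (fun t => integral 0 t (fun s =>
        (k22 t t)^-1 * dt k22 t s * V i s * V j t)).
  rewrite g2E -!addrA; congr (_ + _); rewrite addrA; congr (_ + _).
    rewrite -opprD -big_split -sumrN; apply: eq_bigr => i _ /=.
    by rewrite mE l21E -mulrDr -opprD mulrN addrC.
  by rewrite -sumrN; apply: eq_bigr => i _; rewrite l22E mulrN.
split=> [ab|[ab1 ab2] j].
  by split=> j; have [h1 h2] := ab j; [rewrite firstE|rewrite secondE].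
by split; [rewrite -firstE; exact: ab1|rewrite -secondE; exact: ab2].
Qed.

End DifferentiatedEquation.
End Reduction.

(** Equal convergence order is read as a two-sided bound up to constants for large n. The first
    conjunct keeps the second from being vacuous: the Galerkin coefficients exist and are unique
    from some n on. *)
Theorem theorem3p4 (R : realType) (T : R) (f1 f2 : R -> R)
    (k11 k12 k21 k22 : R -> R -> R) (k0 : R)
    (T_gt0 : 0 < T)
    (f2_0 : f2 0 = 0)
    (f1_C1 : C1_itv T f1) (f2_C1 : C1_itv T f2)
    (k11_C1 : C1_triangle T k11) (k12_C1 : C1_triangle T k12)
    (k21_C1 : C1_triangle T k21) (k22_C1 : C1_triangle T k22)
    (k0_gt0 : 0 < k0)
    (k22_ge : forall t : R, t \in `[0, T] -> k0 <= k22 t t)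
    (u : (R -> R) * (R -> R))
    (u_sol : continuous_solution T f1 f2 k11 k12 k21 k22 u) :
  (\forall n \near \oo, exists! ab : 'rV[R]_n * 'rV[R]_n,
     galerkin_system T f1 f2 k11 k12 k21 k22 ab.1 ab.2) /\
  (forall (a b : forall n : nat, 'rV[R]_n)
          (p : nat -> (R -> R) * (R -> R)),
     (\forall n \near \oo,
        galerkin_system T f1 f2 k11 k12 k21 k22 (a n) (b n)) ->
     (forall n, orthogonal_projection T n u (p n)) ->
     (fun n => L2norm T (u - expansion T (a n) (b n)))
       =Theta_\oo (fun n => L2norm T (u - p n))).
Proof.
have T_ge0 := ltW T_gt0.
case: f1_C1 => cf1 _ _; case: f2_C1 => cf2 df2 [df [cdf dfE]].
have [ck11 _ _] := k11_C1; have [ck12 _ _] := k12_C1.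
have [ck21 _ _] := k21_C1; have [ck22 _ _] := k22_C1.
have [kt21 [ckt21 dk21 kt21E]] := C1_triangle_dt k21_C1.
have [kt22 [ckt22 dk22 kt22E]] := C1_triangle_dt k22_C1.
have k22_neq0 : {in `[0, T], forall t, k22 t t != 0}.
  by move=> t tT; rewrite gt_eqF// (lt_le_trans k0_gt0 (k22_ge t tT)).
have [cx cy eq1 eq2] := u_sol.
pose c t := (k22 t t)^-1.
pose m t := - c t * k21 t t.
pose g2 t := - c t * df t.
pose l21 t s := - c t * kt21 t s.
pose l22 t s := - c t * kt22 t s.
have cNc : cont 0 T (fun t => - c t).
  by apply: contN; apply: contV => //; exact: kernel_diag.
have cm : cont 0 T m by apply: contM => //; exact: kernel_diag.
have cg2 : cont 0 T g2 by exact: contM.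
have cl21 : continuous_on_triangle T l21 by exact: kernelM.
have cl22 : continuous_on_triangle T l22 by exact: kernelM.
have galE n (a b : 'rV[R]_n) : galerkin_system T f1 f2 k11 k12 k21 k22 a b <->
    galerkin_first T k11 k12 f1 a b /\ galerkin_second T l21 l22 m g2 a b.
  by apply: galerkin_systemE => //.
split.
  have [N NP] := galerkin_unique_solution T_gt0 ck11 ck12 cl21 cl22 cm cf1 cg2.
  exists N => // n /= Nn; have [ab [abP uab]] := NP n Nn.
  exists ab; split; first exact/galE.
  by move=> ab' /galE; exact: uab.
move=> a b p gal proj.
have eq2' := differentiated_equation T_gt0 cdf dfE ck21 ck22 ckt21 ckt22 k22_neq0
  cf2 f2_0 df2 dk21 dk22 cx cy eq2.
have eq1' : {in `[0, T], forall t, u.1 t = f1 t + volterra_pair k11 k12 u.1 u.2 t}.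
  move=> t tT; rewrite eq1// integralDc//; exact: cont_volterra_integrand.
have [C C0 [N err]] := galerkin_error T_gt0 ck11 ck12 cl21 cl22 cm cf1 cg2.
(* Constant 1 below, since [expansion T (a n) (b n)] lies in X_n; the root above, since [C] compares
   squared norms. *)
rewrite eqThetaE qualifE; apply/asboolP; exists (1, Num.sqrt C) => /=.
  by rewrite ltr01 sqrtr_gt0.
near=> n.
have galn : galerkin_system T f1 f2 k11 k12 k21 k22 (a n) (b n) by near: n.
have Nn : (N <= n)%N by near: n; exact: nbhs_infty_ge.
rewrite mul1r !ger0_norm ?sqrtr_ge0//; split.
  exact: orthogonal_projection_best.
(* [p n] need not be identified with the coefficientwise projection: the defect is at most the
   distance to any element of X_n. *)
have [[c1 [d1 pE]] _] := proj n.
rewrite !L2normE// -sqrtrM ?(ltW C0)// ler_wsqrtr//.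
have [g1n g2n] := (galE n (a n) (b n)).1 galn.
apply: le_trans (err _ _ cx cy eq1' eq2' n (a n) (b n) Nn g1n g2n) _.
rewrite ler_pM2l// lerD// pE.
  exact: sqn_defect_best.
exact: sqn_defect_best.
Unshelve. all: by end_near. Qed.
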